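(* $\mathcal{Q}$-\textsc{FO-Model-Checking} is W[$t$]-hard for every integer $t\geq 1$.
   Context: The $d$-dimensional hypercube $Q_d$ is the graph with vertex set $\{0,1\}^d$, two vertices adjacent iff they differ in exactly one coordinate. $\mathcal{Q}^r_d$ denotes the class of graphs that are induced subgraphs of the $r$-th power of $Q_d$, with vertices given explicitly as vectors. $\mathcal{Q}$-\textsc{FO-Model-Checking}: given a first-order formula $\Phi$ over the signature of graphs (a binary adjacency relation $E$ and equality), integers $d,r$, and a graph $G\in\mathcal{Q}^r_d$, decide whether $G\models\Phi$; the parameter is $|\Phi|$, the length of the formula. W[$t$]-hardness refers to the W-hierarchy under parameterized (FPT) reductions. *)

(* Defs.v *)
From HB Require Import structures.
From mathcomp Require Import all_boot.

Set Implicit Arguments.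
Unset Strict Implicit.
Unset Printing Implicit Defensive.

Definition update (A : Type) (s : nat -> A) (x : nat) (v : A) : nat -> A :=
  fun y => if y == x then v else s y.

(* Computations are programs of Jones' WHILE language, whose data are binary
   trees. *)

Inductive tree := Leaf | Node of tree & tree.

Fixpoint tree_eq (a b : tree) : bool :=
  match a, b with
  | Leaf, Leaf => true
  | Node a1 a2, Node b1 b2 => tree_eq a1 b1 && tree_eq a2 b2
  | _, _ => false
  end.

Lemma tree_eqP : Equality.axiom tree_eq.
Proof.
elim=> [|a1 IH1 a2 IH2] [|b1 b2] /=; try by constructor.
apply: (iffP andP) => [[/IH1 -> /IH2 ->] // | [<- <-]].
by split; [apply/IH1 | apply/IH2].
Qed.

HB.instance Definition _ := hasDecEq.Build tree tree_eqP.

Fixpoint tree_size (a : tree) : nat :=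
  if a is Node a1 a2 then (tree_size a1 + tree_size a2).+1 else 1.

Definition store := nat -> tree.

Inductive expr :=
  | EVar of nat
  | ENil
  | ECons of expr & expr
  | EHd of expr
  | ETl of expr
  | EEq of expr & expr.

Inductive cmd :=
  | CAssign of nat & expr
  | CSeq of cmd & cmd
  | CIf of expr & cmd & cmd
  | CWhile of expr & cmd.

Definition tree_of_bool (b : bool) : tree := if b then Node Leaf Leaf else Leaf.

Fixpoint eval (s : store) (e : expr) : tree :=
  match e with
  | EVar x => s x
  | ENil => Leaf
  | ECons e1 e2 => Node (eval s e1) (eval s e2)
  | EHd e1 => if eval s e1 is Node a _ then a else Leaf
  | ETl e1 => if eval s e1 is Node _ b then b else Leaf
  | EEq e1 e2 => tree_of_bool (eval s e1 == eval s e2)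
  end.

(* Reading a variable is charged the size of its content.  Hence every value
   is no larger than the time spent to produce it (trees cannot be duplicated
   for free), and time agrees with Turing-machine time up to a polynomial. *)
Fixpoint expr_cost (s : store) (e : expr) : nat :=
  match e with
  | EVar x => tree_size (s x)
  | ENil => 1
  | ECons e1 e2 | EEq e1 e2 => (expr_cost s e1 + expr_cost s e2).+1
  | EHd e1 | ETl e1 => (expr_cost s e1).+1
  end.

(* [exec c s s' t]: started in store s, c halts in store s' after time t.
   In tests, Leaf is false and every other tree is true. *)
Inductive exec : cmd -> store -> store -> nat -> Prop :=
  | exec_assign s x e :
      exec (CAssign x e) s (update s x (eval s e)) (expr_cost s e).+1
  | exec_seq c1 c2 s s1 s2 t1 t2 :
      exec c1 s s1 t1 -> exec c2 s1 s2 t2 ->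
      exec (CSeq c1 c2) s s2 (t1 + t2)
  | exec_if_true e c1 c2 s s1 t1 :
      eval s e <> Leaf -> exec c1 s s1 t1 ->
      exec (CIf e c1 c2) s s1 ((expr_cost s e).+1 + t1)
  | exec_if_false e c1 c2 s s2 t2 :
      eval s e = Leaf -> exec c2 s s2 t2 ->
      exec (CIf e c1 c2) s s2 ((expr_cost s e).+1 + t2)
  | exec_while_false e c s :
      eval s e = Leaf -> exec (CWhile e c) s s (expr_cost s e).+1
  | exec_while_true e c s s1 s2 t1 t2 :
      eval s e <> Leaf -> exec c s s1 t1 -> exec (CWhile e c) s1 s2 t2 ->
      exec (CWhile e c) s s2 ((expr_cost s e).+1 + t1 + t2).

(* Variable 0 holds both the input and the output; all other variables
   are initially Leaf. *)
Definition computes_in (p : cmd) (input output : tree) (t : nat) : Prop :=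
  exists2 s, exec p (update (fun=> Leaf) 0 input) s t & s 0 = output.

(* Unary.  All numbers in the instances below are parameters, indices or
   dimensions of explicitly listed objects, except for the exponent r of the
   cube, where only min(r, d) matters. *)
Fixpoint enc_nat (n : nat) : tree :=
  if n is m.+1 then Node Leaf (enc_nat m) else Leaf.

Definition enc_seq (A : Type) (enc : A -> tree) (s : seq A) : tree :=
  foldr (fun a acc => Node (enc a) acc) Leaf s.

Definition computable (f : nat -> nat) : Prop :=
  exists p, forall n, exists t, computes_in p (enc_nat n) (enc_nat (f n)) t.

(* A language of pairs (instance, parameter); trees that encode no instance
   are no-instances. *)
Definition param_problem := tree -> nat -> Prop.

Definition fpt_reduces (P Q : param_problem) : Prop :=
  exists (p : cmd) (f g : nat -> nat) (c : nat),
    [/\ computable f, computable g &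
      forall x k, exists x' k' t,
        [/\ computes_in p (Node x (enc_nat k)) (Node x' (enc_nat k')) t,
            t <= f k * tree_size x ^ c,
            k' <= g k
          & P x k <-> Q x' k']].

(* Gates refer to their in-neighbours by position. *)
Inductive gate :=
  | GInput
  | GNot of nat
  | GAnd of seq nat
  | GOr of seq nat.

Definition preds (g : gate) : seq nat :=
  match g with
  | GInput => [::]
  | GNot i => [:: i]
  | GAnd s | GOr s => s
  end.

Definition is_input (g : gate) : bool := if g is GInput then true else false.

(* A circuit is the list of its nodes in topological order. *)
Definition circuit := seq gate.

Definition node (C : circuit) (j : nat) : gate := nth GInput C j.

Definition edge (C : circuit) : rel nat := fun i j => i \in preds (node C j).

Definition gate_wf (j : nat) (g : gate) : bool :=
  [&& uniq (preds g), all (fun i => i < j) (preds g) &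
      match g with
      | GAnd s | GOr s => 1 < size s
      | _ => true
      end].

Definition circuit_wf (C : circuit) : bool :=
  all (fun j => gate_wf j (node C j)) (iota 0 (size C)).

Definition is_output (C : circuit) (o : nat) : bool :=
  (o < size C) && all (fun g => o \notin preds g) C.

(* [i :: p] is a directed path from an input node to the output node o. *)
Definition io_path (C : circuit) (o i : nat) (p : seq nat) : Prop :=
  [/\ i < size C, is_input (node C i), path (edge C) i p & last i p = o].

Definition depth_le (C : circuit) (o h : nat) : Prop :=
  forall i p, io_path C o i p -> size p <= h.

Definition large (g : gate) : bool := 2 < size (preds g).

Definition weft_le (C : circuit) (o t : nat) : Prop :=
  forall i p, io_path C o i p -> count (fun j => large (node C j)) (i :: p) <= t.

Definition gate_val (inp : bool) (vals : seq bool) (g : gate) : bool :=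
  match g with
  | GInput => inp
  | GNot i => ~~ nth false vals i
  | GAnd s => all (nth false vals) s
  | GOr s => has (nth false vals) s
  end.

(* Values of all nodes, in order, when input node i receives the value a i. *)
Definition circuit_vals (a : nat -> bool) (C : circuit) : seq bool :=
  foldl (fun vals g => rcons vals (gate_val (a (size vals)) vals g)) [::] C.

Definition weight (a : nat -> bool) (C : circuit) : nat :=
  count (fun i => is_input (node C i) && a i) (iota 0 (size C)).

Definition enc_gate (g : gate) : tree :=
  match g with
  | GInput => Node (enc_nat 0) Leaf
  | GNot i => Node (enc_nat 1) (enc_nat i)
  | GAnd s => Node (enc_nat 2) (enc_seq enc_nat s)
  | GOr s => Node (enc_nat 3) (enc_seq enc_nat s)
  end.

(* Weighted circuit satisfiability for circuits of weft at most t and depth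
   at most h; the parameter is the weight. *)
Definition WCS (t h : nat) : param_problem := fun x k =>
  exists (C : circuit) (o : nat),
    [/\ x = Node (enc_seq enc_gate C) (enc_nat o),
        circuit_wf C && is_output C o,
        weft_le C o t,
        depth_le C o h
      & exists2 a : nat -> bool, weight a C = k & nth false (circuit_vals a C) o].

(* W[t] is the closure of the problems WCS t h, h constant, under
   fpt-reductions. *)
Definition in_W (t : nat) (P : param_problem) : Prop :=
  exists2 h, 1 <= h & fpt_reduces P (WCS t h).

Definition W_hard (t : nat) (Q : param_problem) : Prop :=
  forall P, in_W t P -> fpt_reduces P Q.

Inductive fo :=
  | FAdj of nat & nat
  | FEq of nat & nat
  | FNot of fo
  | FAnd of fo & fo
  | FOr of fo & fo
  | FEx of nat & fo
  | FAll of nat & fo.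

(* Number of symbols, a variable counting as one symbol. *)
Fixpoint fo_length (phi : fo) : nat :=
  match phi with
  | FAdj _ _ | FEq _ _ => 3
  | FNot f => (fo_length f).+1
  | FAnd f g | FOr f g => (fo_length f + fo_length g).+1
  | FEx _ f | FAll _ f => (fo_length f).+2
  end.

Fixpoint free_vars (phi : fo) : seq nat :=
  match phi with
  | FAdj x y | FEq x y => [:: x; y]
  | FNot f => free_vars f
  | FAnd f g | FOr f g => free_vars f ++ free_vars g
  | FEx x f | FAll x f => [seq y <- free_vars f | y != x]
  end.

Definition sentence (phi : fo) : bool := nilp (free_vars phi).

Fixpoint fo_sat (V : Type) (E : V -> V -> Prop) (a : nat -> V) (phi : fo) : Prop :=
  match phi with
  | FAdj x y => E (a x) (a y)
  | FEq x y => a x = a y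
  | FNot f => ~ fo_sat E a f
  | FAnd f g => fo_sat E a f /\ fo_sat E a g
  | FOr f g => fo_sat E a f \/ fo_sat E a g
  | FEx x f => exists v, fo_sat E (update a x v) f
  | FAll x f => forall v, fo_sat E (update a x v) f
  end.

(* Used for sentences over a nonempty vertex set only, where the choice of
   the assignment is irrelevant. *)
Definition models (V : Type) (E : V -> V -> Prop) (phi : fo) : Prop :=
  forall a : nat -> V, fo_sat E a phi.

Fixpoint enc_fo (phi : fo) : tree :=
  match phi with
  | FAdj x y => Node (enc_nat 0) (Node (enc_nat x) (enc_nat y))
  | FEq x y => Node (enc_nat 1) (Node (enc_nat x) (enc_nat y))
  | FNot f => Node (enc_nat 2) (enc_fo f)
  | FAnd f g => Node (enc_nat 3) (Node (enc_fo f) (enc_fo g))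
  | FOr f g => Node (enc_nat 4) (Node (enc_fo f) (enc_fo g))
  | FEx x f => Node (enc_nat 5) (Node (enc_nat x) (enc_fo f))
  | FAll x f => Node (enc_nat 6) (Node (enc_nat x) (enc_fo f))
  end.

Definition hypercube (d : nat) : rel (d.-tuple bool) :=
  fun u v => #|[set i | tnth u i != tnth v i]| == 1.

(* Adjacency in the r-th power: distinct, and joined by a walk of length at most r. *)
Definition power (T : eqType) (e : rel T) (r : nat) (u v : T) : Prop :=
  u <> v /\ exists p, [/\ path e u p, last u p = v & size p <= r].

Definition induced (T : eqType) (E : T -> T -> Prop) (vs : seq T)
    (u v : {w : T | w \in vs}) : Prop :=
  E (sval u) (sval v).

(* The graph is given by the list vs of its vertices. *)
Definition enc_instance (phi : fo) (d r : nat) (vs : seq (d.-tuple bool)) : tree :=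
  Node (enc_fo phi)
    (Node (enc_nat d)
      (Node (enc_nat r) (enc_seq (enc_seq tree_of_bool) (map val vs)))).

Definition Q_FO_model_checking : param_problem := fun x k =>
  exists (phi : fo) (d r : nat) (vs : seq (d.-tuple bool)),
    [/\ x = enc_instance phi r vs,
        [&& sentence phi, uniq vs & ~~ nilp vs],
        fo_length phi = k
      & models (@induced _ (power (@hypercube d) r) vs) phi].

(* Main.v *)
(** Fix h.  Whether a circuit of depth at most h accepts some assignment of
    weight k is a first-order question about the circuit: choose k distinct
    input nodes and evaluate the output by a formula that descends h levels of
    quantifiers, so the weft plays no role.  The circuit is rewritten as an
    acyclic network of NAND gates; a node v becomes a vertex A_v and two twins
    B_v, B'_v, where A_u ~ A_v when there is an arc between u and v, and
    A_u ~ B_v when u <= v in the topological order.  Twins are definable, hence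
    so are the order and the orientation of the arcs.  Finally every graph on N
    vertices is an induced subgraph of the (4 N - 2)-nd power of a cube of
    dimension 2 N^2. *)

(* The formula may depend on h and k only, so every fact about the circuit has to be recovered from
   a graph without colours and directions; this is the task of the twins. NAND gates make all levels
   of the evaluation alike: a gate is true iff some in-neighbour is false, which is one existential
   quantifier and one negation. Three gates per node keep the depth linear in h, and the order makes
   the output definable, as the greatest gate.

   An input that codes no well-formed circuit, or one of too large weft or depth, is a no-instance
   of [WCS] and must not become a yes-instance. The reduction therefore verifies all these
   conditions itself, which is polynomial because h and t are constants.

   The reduction must be an actual WHILE program. It is assembled from closure properties of the
   polynomial-time functions on typed data. The programs obtained work for arbitrary contents of
   their scratch variables, so they can be run directly after the unknown program of the given
   reduction. *)
Require Import Defs.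
From mathcomp Require Import all_boot zify.

Set Implicit Arguments.
Unset Strict Implicit.
Unset Printing Implicit Defensive.

(** * Polynomial-time WHILE programs *)

(** The base n + 1 is positive even for n = 0, so exponents can be raised freely when two bounds are
    added. *)
Definition pol (C D n : nat) : nat := C * n.+1 ^ D.

Definition poly_bounded (T : nat -> nat) : Prop :=
  exists C D, forall n, T n <= pol C D n.

Lemma leq_exp2r' m n D : m <= n -> m ^ D <= n ^ D.
Proof. by case: D => // D; rewrite leq_exp2r. Qed.

Lemma pol_mono C D : {homo pol C D : m n / m <= n}.
Proof. by move=> m n le_mn; rewrite leq_mul2l leq_exp2r' ?orbT. Qed.

Lemma poly_bounded_const c : poly_bounded (fun=> c).
Proof. by exists c, 0 => n; rewrite /pol expn0 muln1. Qed.

Lemma poly_bounded_id : poly_bounded id.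
Proof. by exists 1, 1 => n; rewrite /pol expn1 mul1n leqW. Qed.

Lemma poly_boundedD (T1 T2 : nat -> nat) :
  poly_bounded T1 -> poly_bounded T2 -> poly_bounded (fun n => T1 n + T2 n).
Proof.
move=> [C1 [D1 h1]] [C2 [D2 h2]]; exists (C1 + C2), (D1 + D2) => n.
rewrite /pol mulnDl; apply: leq_add.
  by apply: leq_trans (h1 n) _; rewrite leq_mul2l leq_pexp2l ?orbT ?leq_addr.
by apply: leq_trans (h2 n) _; rewrite leq_mul2l leq_pexp2l ?orbT ?leq_addl.
Qed.

Lemma poly_boundedM (T1 T2 : nat -> nat) :
  poly_bounded T1 -> poly_bounded T2 -> poly_bounded (fun n => T1 n * T2 n).
Proof.
move=> [C1 [D1 h1]] [C2 [D2 h2]]; exists (C1 * C2), (D1 + D2) => n.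
by rewrite /pol expnD mulnACA leq_mul.
Qed.

Lemma poly_bounded_pol C D (T : nat -> nat) :
  poly_bounded T -> poly_bounded (fun n => pol C D (T n)).
Proof.
move=> [C1 [D1 h1]]; exists (C * C1.+1 ^ D), (D1 * D) => n.
rewrite /pol expnM -mulnA -expnMn leq_mul2l leq_exp2r' ?orbT //.
by rewrite mulSn -add1n leq_add ?expn_gt0 ?h1.
Qed.

Lemma poly_boundedS (T : nat -> nat) :
  poly_bounded T -> poly_bounded (fun n => (T n).+1).
Proof.
by move=> hT; apply: poly_boundedD (poly_bounded_const 1) hT.
Qed.

Ltac poly_bound :=
  repeat first
    [ exact: poly_bounded_id | exact: poly_bounded_const
    | apply: poly_bounded_pol
    | apply: poly_boundedS | apply: poly_boundedD | apply: poly_boundedM ].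

Lemma tree_size_gt0 a : 0 < tree_size a.
Proof. by case: a. Qed.

Lemma eval_size s e : tree_size (eval s e) <= expr_cost s e.
Proof.
elim: e => //= [e1 h1 e2 h2|e h|e h|e1 h1 e2 h2].
- by rewrite ltnS leq_add.
- by case: (eval s e) h => //= a b; lia.
- by case: (eval s e) h => //= a b; lia.
by have := tree_size_gt0 (eval s e1); have := tree_size_gt0 (eval s e2); case: eqP => _ /=; lia.
Qed.

(** Only assignments change the store, and each is charged at least the size of the value written;
    so no variable grows faster than the clock runs. *)
Lemma exec_size c s s' t :
  exec c s s' t -> forall x, tree_size (s' x) <= tree_size (s x) + t.
Proof.
elim=> {c s s' t}.
- move=> s x e y; rewrite /update; case: eqP => _; last by rewrite leq_addr.
  by have := eval_size s e; lia.
- by move=> c1 c2 s s1 s2 t1 t2 _ h1 _ h2 x; move: (h1 x) (h2 x); lia.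
- by move=> e c1 c2 s s1 t1 _ _ h1 x; move: (h1 x); lia.
- by move=> e c1 c2 s s1 t1 _ _ h1 x; move: (h1 x); lia.
- by move=> e c s _ x; lia.
by move=> e c s s1 s2 t1 t2 _ _ h1 _ h2 x; move: (h1 x) (h2 x); lia.
Qed.

(** * Typed data and polynomial-time functions *)

Class encodable (A : Type) := encode : A -> tree.

#[global] Instance encodable_tree : encodable tree := id.
#[global] Instance encodable_unit : encodable unit := fun=> Leaf.
#[global] Instance encodable_bool : encodable bool := tree_of_bool.
#[global] Instance encodable_nat : encodable nat := enc_nat.
#[global] Instance encodable_pair A B {eA : encodable A} {eB : encodable B} :
  encodable (A * B) := fun p => Node (encode p.1) (encode p.2).
#[global] Instance encodable_seq A {eA : encodable A} : encodable (seq A) :=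
  enc_seq encode.
#[global] Instance encodable_gate : encodable gate := enc_gate.
(* A formula is stored with its length in unary, which is the parameter of the
   produced instance. *)
#[global] Instance encodable_fo : encodable fo :=
  fun phi => Node (enc_fo phi) (enc_nat (fo_length phi)).

(* The program may clobber any variable below N, whose initial contents are
   arbitrary except for the input. *)
Definition implements {A B} {eA : encodable A} {eB : encodable B}
    (f : A -> B) (c : cmd) (N : nat) (T : nat -> nat) : Prop :=
  forall s a, s 0 = encode a -> exists s' t,
    [/\ exec c s s' t, s' 0 = encode (f a), forall x, N <= x -> s' x = s x
      & t <= T (tree_size (encode a))].

(** By 0 < N, variable 0 is one of those that may be clobbered; the variables from N on can hold
    values across a call. *)
Definition ptime {A B} {eA : encodable A} {eB : encodable B} (f : A -> B) : Prop :=
  exists c N C D, 0 < N /\ implements f c N (pol C D).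

Lemma ptime_implements {A B} {eA : encodable A} {eB : encodable B}
    (f : A -> B) c N T :
  0 < N -> poly_bounded T -> implements f c N T -> ptime f.
Proof.
move=> N_gt0 [C [D hT]] hc; exists c, N, C, D; split=> // s a sa.
have [s' [t [h1 h2 h3 h4]]] := hc s a sa; exists s', t; split=> //.
exact: leq_trans h4 (hT _).
Qed.

(** An output is no larger than the input plus the running time. This controls the input of the
    second program in a composition. *)
Lemma ptime_size {A B} {eA : encodable A} {eB : encodable B} (f : A -> B) :
  ptime f -> exists C D, forall a,
    tree_size (encode (f a)) <= pol C D (tree_size (encode a)).
Proof.
move=> [c [N [C [D [_ hc]]]]].
have [C' [D' h]] : poly_bounded (fun n => n + pol C D n) by poly_bound.
exists C', D' => a.
have [s' [t [h1 <- _ h4]]] := hc (fun=> encode a) a (erefl _).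
by apply: leq_trans (exec_size h1 0) _; apply: leq_trans (h _); rewrite leq_add2l.
Qed.

(** Programs see only codes, so a function may change its type for free wherever the codes coincide;
    for instance, pairing also gives [cons] and the gate constructors. *)
Lemma ptime_enc {A B B'} {eA : encodable A} {eB : encodable B}
    {eB' : encodable B'} (f : A -> B) (g : A -> B') :
  ptime f -> (forall a, encode (f a) = encode (g a)) -> ptime g.
Proof.
move=> [c [N [C [D [N0 hc]]]]] fg; exists c, N, C, D; split=> // s a sa.
by have [s' [t [h1 h2 h3 h4]]] := hc s a sa; exists s', t; rewrite -fg.
Qed.

Lemma ptime_ext {A B} {eA : encodable A} {eB : encodable B} (f g : A -> B) :
  ptime f -> f =1 g -> ptime g.
Proof. by move=> hf fg; apply: ptime_enc hf _ => a; rewrite fg. Qed.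

Lemma ptime_comp {A B Z} {eA : encodable A} {eB : encodable B} {eZ : encodable Z}
    (f : A -> B) (g : B -> Z) :
  ptime f -> ptime g -> ptime (fun a => g (f a)).
Proof.
move=> hf; have [C' [D' hsz]] := ptime_size hf; move: hf.
move=> [c1 [N1 [C1 [D1 [N1_gt0 h1]]]]] [c2 [N2 [C2 [D2 [_ h2]]]]].
apply: (@ptime_implements _ _ _ _ _ (CSeq c1 c2) (maxn N1 N2)
  (fun n => pol C1 D1 n + pol C2 D2 (pol C' D' n))); [lia | by poly_bound |].
move=> s a sa; have [s1 [t1 [e1 v1 f1 b1]]] := h1 s a sa.
have [s2 [t2 [e2 v2 f2 b2]]] := h2 s1 _ v1.
exists s2, (t1 + t2); split=> //.
- exact: exec_seq e1 e2.
- by move=> x; rewrite geq_max => /andP[x1 x2]; rewrite f2 ?f1.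
by rewrite leq_add //; apply: leq_trans b2 _; apply: pol_mono.
Qed.

Lemma updateE A (s : nat -> A) x v y : update s x v y = if y == x then v else s y.
Proof. by []. Qed.

Lemma update_eq A (s : nat -> A) x v : update s x v x = v.
Proof. by rewrite /update eqxx. Qed.

Lemma update_neq A (s : nat -> A) x v y : y != x -> update s x v y = s y.
Proof. by rewrite /update => /negPf ->. Qed.

(** Scratch variables may contain anything, so the cost of an expression is controlled by the input
    size when it reads variable 0 alone. *)
Definition uses0 (e : expr) : bool :=
  (fix u e := match e with
   | EVar x => x == 0 | ENil => true | ECons a b | EEq a b => u a && u b
   | EHd a | ETl a => u a end) e.

Fixpoint expr_size (e : expr) : nat :=
  match e with
  | EVar _ | ENil => 1
  | ECons a b | EEq a b => (expr_size a + expr_size b).+1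
  | EHd a | ETl a => (expr_size a).+1
  end.

Lemma expr_cost_le s e :
  uses0 e -> expr_cost s e <= expr_size e * (tree_size (s 0)).
Proof.
have := tree_size_gt0 (s 0).
elim: e => /= [x ? /eqP -> //|//|e1 h1 e2 h2 p /andP[/h1 h /h2 k]|e h p /h k|e h p /h k|e1 h1 e2 h2 p /andP[/h1 h /h2 k]]; try lia.
Qed.

(** The elementary tree operations (head, tail, successor, constants, equality tests) all come from
    this lemma by a choice of e. *)
Lemma ptime_expr {A B Z} {eA : encodable A} {eB : encodable B} {eZ : encodable Z}
    (e : expr) (f : A -> B) (g : A -> Z) :
  uses0 e -> ptime f ->
  (forall s a, s 0 = encode (f a) -> eval s e = encode (g a)) -> ptime g.
Proof.
move=> e0 hf; have [C' [D' hsz]] := ptime_size hf; move: hf.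
move=> [c1 [N1 [C1 [D1 [N1_gt0 h1]]]]] he.
apply: (@ptime_implements _ _ _ _ _ (CSeq c1 (CAssign 0 e)) N1
  (fun n => pol C1 D1 n + (expr_size e * pol C' D' n).+1)) => //; first by poly_bound.
move=> s a sa; have [s1 [t1 [e1 v1 f1 b1]]] := h1 s a sa.
exists (update s1 0 (eval s1 e)), (t1 + (expr_cost s1 e).+1); split.
- by apply: exec_seq e1 _; apply: exec_assign.
- by rewrite update_eq; apply: he.
- by move=> x N1x; rewrite update_neq ?f1 //; lia.
rewrite leq_add // ltnS; apply: leq_trans (expr_cost_le _ e0) _.
by rewrite v1 leq_mul2l hsz orbT.
Qed.

Lemma ptime_id {A} {eA : encodable A} : ptime (fun a : A => a).
Proof.
apply: (@ptime_implements _ _ _ _ _ (CAssign 0 (EVar 0)) 1 (fun n => n.+1)) => //.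
  by poly_bound.
move=> s a sa; exists (update s 0 (eval s (EVar 0))), (expr_cost s (EVar 0)).+1.
split; first exact: exec_assign.
- by rewrite update_eq.
- by move=> x x1; rewrite update_neq //; lia.
by rewrite /= sa.
Qed.

Fixpoint expr_of_tree (a : tree) : expr :=
  if a is Node b c then ECons (expr_of_tree b) (expr_of_tree c) else ENil.

Lemma ptime_const {A B} {eA : encodable A} {eB : encodable B} (b : B) :
  ptime (fun _ : A => b).
Proof.
apply: (@ptime_expr _ _ _ _ _ _ (expr_of_tree (encode b)) id) (ptime_id) _.
  by elim: (encode b) => //= x -> y ->.
by move=> s _ _; elim: (encode b) => //= x -> y ->.
Qed.

(* The argument is saved in variable N while f is computed, and the value of f
   in variable N + 1 while g is computed. *)
Lemma ptime_pair {A B Z} {eA : encodable A} {eB : encodable B} {eZ : encodable Z}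
    (f : A -> B) (g : A -> Z) :
  ptime f -> ptime g -> ptime (fun a => (f a, g a)).
Proof.
move=> hf hg; have [C3 [D3 hsz]] := ptime_size hf; have [C4 [D4 hsz']] := ptime_size hg; move: hf hg.
move=> [c1 [N1 [C1 [D1 [N1_gt0 h1]]]]] [c2 [N2 [C2 [D2 [N2_gt0 h2]]]]].
pose N := maxn N1 N2.
apply: (@ptime_implements _ _ _ _ _
  (CSeq (CAssign N (EVar 0)) (CSeq c1 (CSeq (CAssign N.+1 (EVar 0))
    (CSeq (CAssign 0 (EVar N)) (CSeq c2
     (CAssign 0 (ECons (EVar N.+1) (EVar 0)))))))) N.+2
  (fun n => n.+1 + (pol C1 D1 n + ((pol C3 D3 n).+1 + (n.+1 + (pol C2 D2 n +
     (pol C3 D3 n + pol C4 D4 n).+2)))))); first lia.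
  by poly_bound.
move=> s a sa.
pose s0 := update s N (s 0).
have [|s1 [t1 [e1 v1 f1 b1]]] := h1 s0 a; first by rewrite /s0 updateE sa; case: ifP.
pose s2 := update s1 N.+1 (s1 0).
pose s3 := update s2 0 (s2 N).
have s3N : s3 N.+1 = s1 0 by rewrite /s3 update_neq // /s2 update_eq.
have s2N : s2 N = encode a.
  by rewrite /s2 update_neq ?f1 ?leq_maxl // /s0 ?update_eq ?sa //; lia.
have [|s4 [t4 [e4 v4 f4 b4]]] := h2 s3 a; first by rewrite /s3 update_eq.
pose s5 := update s4 0 (Node (s4 N.+1) (s4 0)).
have s4N : s4 N.+1 = encode (f a) by rewrite f4 ?s3N ?v1 //; lia.
eexists s5, (_ + (_ + (_ + (_ + (_ + _))))); split.
- apply: exec_seq (exec_assign _ _ _) _; apply: exec_seq e1 _.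
  apply: exec_seq (exec_assign _ _ _) _; apply: exec_seq (exec_assign _ _ _) _.
  by apply: exec_seq e4 (exec_assign _ _ _).
- by rewrite /s5 update_eq s4N v4.
- move=> x xN; rewrite /s5 update_neq ?f4 /s3 ?update_neq /s2 ?update_neq ?f1 /s0 ?update_neq //; lia.
rewrite /= -/s2 sa s2N v1 s4N v4; have := hsz a; have := hsz' a; lia.
Qed.

Lemma ptime_if {A B} {eA : encodable A} {eB : encodable B}
    (b : A -> bool) (f g : A -> B) :
  ptime b -> ptime f -> ptime g -> ptime (fun a => if b a then f a else g a).
Proof.
move=> [c0 [N0 [C0 [D0 [N0_gt0 h0]]]]] [c1 [N1 [C1 [D1 [N1_gt0 h1]]]]] [c2 [N2 [C2 [D2 [N2_gt0 h2]]]]].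
pose N := maxn N0 (maxn N1 N2).
apply: (@ptime_implements _ _ _ _ _
  (CSeq (CAssign N (EVar 0)) (CSeq c0 (CSeq (CAssign N.+1 (EVar 0))
    (CSeq (CAssign 0 (EVar N)) (CIf (EVar N.+1) c1 c2))))) N.+2
  (fun n => n.+1 + (pol C0 D0 n + (4 + (n.+1 + (4 + (pol C1 D1 n + pol C2 D2 n))))))); first lia.
  by poly_bound.
move=> s a sa.
pose s0 := update s N (s 0).
have [|s1 [t1 [e1 v1 f1 b1]]] := h0 s0 a; first by rewrite /s0 updateE sa; case: ifP.
pose s2 := update s1 N.+1 (s1 0).
pose s3 := update s2 0 (s2 N).
have s3N : s3 N.+1 = encode (b a) by rewrite /s3 update_neq // /s2 update_eq.
have s2N : s2 N = encode a.
  by rewrite /s2 update_neq ?f1 ?leq_maxl // /s0 ?update_eq ?sa //; lia.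
(* This is the origin of the two summands 4 in the time bound: one for saving the Boolean, one for
   testing it. *)
have sb (b' : bool) : tree_size (encode b') <= 3 by case: b'.
have pre t s' : exec (CIf (EVar N.+1) c1 c2) s3 s' t ->
  exec (CSeq (CAssign N (EVar 0)) (CSeq c0 (CSeq (CAssign N.+1 (EVar 0))
    (CSeq (CAssign 0 (EVar N)) (CIf (EVar N.+1) c1 c2))))) s s'
   ((expr_cost s (EVar 0)).+1 + (t1 + ((expr_cost s1 (EVar 0)).+1 + ((expr_cost s2 (EVar N)).+1 + t)))).
  move=> e3; apply: exec_seq (exec_assign _ _ _) _; apply: exec_seq e1 _.
  by apply: exec_seq (exec_assign _ _ _) _; apply: exec_seq (exec_assign _ _ _) _.
have fr s4 N' x : N' <= N -> (forall x, N' <= x -> s4 x = s3 x) -> N.+2 <= x -> s4 x = s x.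
  move=> le f4 xN; rewrite ?f4 /s3 ?update_neq /s2 ?update_neq ?f1 /s0 ?update_neq //; lia.
have s30 : s3 0 = encode a by rewrite /s3 update_eq.
case ba: (b a).
- have [s4 [t4 [e4 v4 f4 b4]]] := h1 s3 a s30.
  have E : exec (CIf (EVar N.+1) c1 c2) s3 s4 ((expr_cost s3 (EVar N.+1)).+1 + t4).
    by apply: exec_if_true e4; rewrite /= s3N ba.
  exists s4; eexists; split; [exact: pre E | by [] | | ].
    + by move=> x; apply: fr f4; lia.
  by rewrite /= -/s2 -/s3 sa s2N v1 s3N; have := sb (b a); lia.
have [s4 [t4 [e4 v4 f4 b4]]] := h2 s3 a s30.
have E : exec (CIf (EVar N.+1) c1 c2) s3 s4 ((expr_cost s3 (EVar N.+1)).+1 + t4).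
    by apply: exec_if_false e4; rewrite /= s3N ba.
exists s4; eexists; split; [exact: pre E | by [] | | ].
+ by move=> x; apply: fr f4; lia.
by rewrite /= -/s2 -/s3 sa s2N v1 s3N; have := sb (b a); lia.
Qed.

Arguments encode : simpl never.

Lemma encode_gt0 {A} {eA : encodable A} (a : A) : 0 < tree_size (encode a).
Proof. exact: tree_size_gt0. Qed.

Lemma encode_pair_size {A B} {eA : encodable A} {eB : encodable B} (a : A) (b : B) :
  tree_size (encode (a, b)) = (tree_size (encode a) + tree_size (encode b)).+1.
Proof. by []. Qed.

Lemma encode_cons_size {A} {eA : encodable A} (h : A) l :
  tree_size (encode (h :: l)) = (tree_size (encode h) + tree_size (encode l)).+1.
Proof. by []. Qed.

Lemma encode_cons {A} {eA : encodable A} (h : A) l :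
  encode (h :: l) = Node (encode h) (encode l).
Proof. by []. Qed.

(** A loop consumes a list from its head, whereas [foldr] starts with the last element. Reversing
    the list first reconciles the two. *)
Lemma rev_loop {A} {eA : encodable A} x y (l1 l2 : seq A) s :
  x != y -> s x = encode l1 -> s y = encode l2 ->
  exists s' t,
    [/\ exec (CWhile (EVar x)
          (CSeq (CAssign y (ECons (EHd (EVar x)) (EVar y)))
                (CAssign x (ETl (EVar x))))) s s' t,
        s' y = encode (catrev l1 l2),
        forall z, z != x -> z != y -> s' z = s z
      & t <= (size l1).+1 *
             (4 * (tree_size (encode l1) + tree_size (encode l2)) + 10)].
Proof.
move=> xy; elim: l1 l2 s => [|h l IH] l2 s sx sy.
  exists s, (expr_cost s (EVar x)).+1; split=> //.
    by apply: exec_while_false; rewrite /= sx.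
  by rewrite /= sx /=; lia.
pose s1 := update s y (eval s (ECons (EHd (EVar x)) (EVar y))).
pose s2 := update s1 x (eval s1 (ETl (EVar x))).
have s1x : s1 x = Node (encode h) (encode l) by rewrite /s1 update_neq // sx.
have [||s' [t [e v f b]]] := IH (h :: l2) s2.
- by rewrite /s2 update_eq /= -/s1 s1x.
- by rewrite /s2 update_neq 1?eq_sym // /s1 update_eq /= sx sy.
exists s', ((expr_cost s (EVar x)).+1
  + ((expr_cost s (ECons (EHd (EVar x)) (EVar y))).+1 + (expr_cost s1 (ETl (EVar x))).+1) + t).
split=> //.
- apply: exec_while_true e; first by rewrite /= sx.
  by apply: exec_seq; apply: exec_assign.
- by move=> z zx zy; rewrite f // /s2 update_neq // /s1 update_neq.
move: b; rewrite /= -/s1 s1x sx sy !encode_cons /= mulSn.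
have -> : tree_size (encode l) + (tree_size (encode h) + tree_size (encode l2)).+1 =
  (tree_size (encode h) + tree_size (encode l)).+1 + tree_size (encode l2) by lia.
set P := _.+1 * _; lia.
Qed.

(** Invariant: d is the suffix already folded, r the rest in reverse order, so [catrev r d] is
    always the whole list. M bounds the whole list and K every intermediate accumulator, which makes
    the cost of a round uniform. *)
Lemma fold_loop {A B Z} {eA : encodable A} {eB : encodable B} {eZ : encodable Z}
    (S : A -> B -> Z -> Z) (z0 : Z) c N0 C D N M K a (r d : seq B) s :
  0 < N0 <= N -> implements (fun p : (A * B) * Z => S p.1.1 p.1.2 p.2) c N0 (pol C D) ->
  (forall d', tree_size (encode d') <= M ->
     tree_size (encode (foldr (S a) z0 d')) <= K) ->
  tree_size (encode (catrev r d)) <= M ->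
  s N = encode a -> s N.+1 = encode r -> s 0 = encode (foldr (S a) z0 d) ->
  exists s' t,
    [/\ exec (CWhile (EVar N.+1)
          (CSeq (CAssign 0 (ECons (ECons (EVar N) (EHd (EVar N.+1))) (EVar 0)))
          (CSeq c (CAssign N.+1 (ETl (EVar N.+1)))))) s s' t,
        s' 0 = encode (foldr (S a) z0 (catrev r d)),
        forall z, N.+2 <= z -> s' z = s z
      & t <= (size r).+1 * (tree_size (encode a) + 3 * M + K + 20 +
               pol C D (tree_size (encode a) + M + K + 2))].
Proof.
move=> /andP[N0_gt0 N0N] hc hK; elim: r d s => [|h r IH] d s hM sN sr s0.
  exists s, (expr_cost s (EVar N.+1)).+1; split=> //.
    by apply: exec_while_false; rewrite /= sr.
  by rewrite /= sr /=; lia.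
(* The two lists have one final [Leaf] each, their concatenation only one; hence the successor. *)
have szM (r' d' : seq B) : tree_size (encode r') + tree_size (encode d') <= (tree_size (encode (catrev r' d'))).+1.
  elim: r' d' => [|x r' IHr] d'; first by rewrite /= add1n.
  by apply: leq_trans (IHr (x :: d')); rewrite !encode_cons_size; lia.
have gt0 (r' : seq B) : 0 < tree_size (encode r') by apply: encode_gt0.
have hrd : tree_size (encode (h :: r)) + tree_size (encode d) <= M.+1.
  by apply: leq_trans (szM _ _) _; rewrite ltnS.
have dM : tree_size (encode d) <= M.
  by move: hrd; rewrite encode_cons_size; have := encode_gt0 h; lia.
have hdM : tree_size (encode (h :: d)) <= M.
  have hM' : tree_size (encode (catrev r (h :: d))) <= M by [].
  by have := szM r (h :: d); have := gt0 r; rewrite encode_cons_size; lia.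
pose s1 := update s 0 (eval s (ECons (ECons (EVar N) (EHd (EVar N.+1))) (EVar 0))).
have s1E : s1 0 = encode ((a, h), foldr (S a) z0 d).
  by rewrite /s1 update_eq /= sN sr s0.
have E1 : exec (CAssign 0 (ECons (ECons (EVar N) (EHd (EVar N.+1))) (EVar 0))) s s1 (tree_size (encode a) + (tree_size (encode (h :: r))).+1 + 1 + tree_size (s 0)).+2.
  have -> : (tree_size (encode a) + (tree_size (encode (h :: r))).+1 + 1 + tree_size (s 0)).+2 =
    (expr_cost s (ECons (ECons (EVar N) (EHd (EVar N.+1))) (EVar 0))).+1.
    by rewrite /= sN sr addn1.
  exact: exec_assign.
have [s2 [t2 [e2 v2 f2 b2]]] := hc s1 ((a, h), foldr (S a) z0 d) s1E.
have s2r : s2 N.+1 = encode (h :: r) by rewrite f2 /s1 ?update_neq ?sr //; lia.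
pose s3 := update s2 N.+1 (eval s2 (ETl (EVar N.+1))).
have E3 : exec (CAssign N.+1 (ETl (EVar N.+1))) s2 s3 (tree_size (encode (h :: r))).+2.
  have -> : (tree_size (encode (h :: r))).+2 = (expr_cost s2 (ETl (EVar N.+1))).+1.
    by rewrite /= s2r.
  exact: exec_assign.
have [||||s' [t [e v f b]]] := IH (h :: d) s3 => //.
- by rewrite /s3 update_neq ?f2 /s1 ?update_neq ?sN //; lia.
- by rewrite /s3 update_eq /= s2r.
exists s', ((expr_cost s (EVar N.+1)).+1 + ((tree_size (encode a) + (tree_size (encode (h :: r))).+1 + 1 + tree_size (s 0)).+2
  + (t2 + (tree_size (encode (h :: r))).+2)) + t).
split=> //.
- apply: exec_while_true e; first by rewrite /= sr.
  by apply: exec_seq E1 _; apply: exec_seq e2 E3.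
- by move=> z zN; rewrite f // /s3 update_neq ?f2 /s1 ?update_neq //; lia.
have b2' : t2 <= pol C D (tree_size (encode a) + M + K + 2).
  apply: leq_trans b2 _; apply: pol_mono.
  by have := hK _ dM; move: hdM; rewrite encode_cons_size !encode_pair_size; lia.
have h0 := hK _ dM; rewrite -s0 in h0.
have hr : tree_size (encode (h :: r)) <= M by have := gt0 d; lia.
have -> : expr_cost s (EVar N.+1) = tree_size (encode (h :: r)) by rewrite /= sr.
rewrite [size (h :: r)]/= mulSn; move: b; set P := (size r).+1 * _.
set Q := pol C D _ in b2' *; lia.
Qed.

Lemma size_encode_seq {A} {eA : encodable A} (l : seq A) :
  size l < tree_size (encode l).
Proof. by elim: l => // h l IH; rewrite encode_cons_size [size _]/=; lia. Qed.

(** The size hypothesis excludes steps such as doubling the accumulator: they take polynomial time,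
    but iterating them gives exponentially large values. *)
Lemma ptime_foldr {A B Z} {eA : encodable A} {eB : encodable B} {eZ : encodable Z}
    (S : A -> B -> Z -> Z) (z : A -> Z) (l : A -> seq B) :
  ptime (fun p : (A * B) * Z => S p.1.1 p.1.2 p.2) -> ptime z -> ptime l ->
  (exists C D, forall a d, tree_size (encode (foldr (S a) (z a) d)) <=
     pol C D (tree_size (encode a) + tree_size (encode d))) ->
  ptime (fun a => foldr (S a) (z a) (l a)).
Proof.
move=> hS hz hl [C4 [D4 hK]].
have [C3 [D3 hsz]] := ptime_size hl; have [C5 [D5 hsz']] := ptime_size hz.
move: hS hz hl.
move=> [c0 [N0 [C0 [D0 [N0_gt0 h0]]]]] [c1 [N1 [C1 [D1 [N1_gt0 h1]]]]] [c2 [N2 [C2 [D2 [N2_gt0 h2]]]]].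
pose N := maxn N0 (maxn N1 N2).
pose loop1 := CWhile (EVar N.+2)
          (CSeq (CAssign N.+1 (ECons (EHd (EVar N.+2)) (EVar N.+1)))
                (CAssign N.+2 (ETl (EVar N.+2)))).
pose loop2 := CWhile (EVar N.+1)
          (CSeq (CAssign 0 (ECons (ECons (EVar N) (EHd (EVar N.+1))) (EVar 0)))
          (CSeq c0 (CAssign N.+1 (ETl (EVar N.+1))))).
apply: (@ptime_implements _ _ _ _ _
  (CSeq (CAssign N (EVar 0)) (CSeq c2 (CSeq (CAssign N.+2 (EVar 0))
   (CSeq (CAssign N.+1 ENil) (CSeq loop1
    (CSeq (CAssign 0 (EVar N)) (CSeq c1 loop2))))))) N.+3
  (fun n => n.+1 + (pol C2 D2 n + ((pol C3 D3 n).+1 + (2 +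
    (pol C3 D3 n * (4 * (pol C3 D3 n + 1) + 10) + (n.+1 + (pol C1 D1 n +
    pol C3 D3 n * (n + 3 * pol C3 D3 n + pol C4 D4 (n + pol C3 D3 n) + 20
     + pol C0 D0 (n + pol C3 D3 n + pol C4 D4 (n + pol C3 D3 n) + 2))))))))));
  first lia.
  by poly_bound.
move=> s a sa.
pose s0 := update s N (s 0).
have [|s1 [t1 [e1 v1 f1 b1]]] := h2 s0 a; first by rewrite /s0 updateE sa; case: ifP.
pose s2 := update s1 N.+2 (s1 0).
pose s3 := update s2 N.+1 Leaf.
have [|||s4 [t4 [e4 v4 f4 b4]]] := @rev_loop _ _ N.+2 N.+1 (l a) [::] s3; first lia.
- by rewrite /s3 update_neq /s2 ?update_eq //; lia.
- by rewrite /s3 update_eq.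
pose s5 := update s4 0 (s4 N).
have s3N : s3 N = encode a.
  by rewrite /s3 update_neq /s2 ?update_neq ?f1 /s0 ?update_eq ?sa //; lia.
have s4N : s4 N = encode a by rewrite f4 ?s3N //; lia.
have [|s6 [t6 [e6 v6 f6 b6]]] := h1 s5 a; first by rewrite /s5 update_eq s4N.
have [||||||s7 [t7 [e7 v7 f7 b7]]] := @fold_loop _ _ _ _ _ _ S (z a) c0 N0 C0 D0 N
  (tree_size (encode (l a))) (pol C4 D4 (tree_size (encode a) + tree_size (encode (l a))))
  a (rev (l a)) [::] s6 _ h0; first lia.
- by move=> d hd; apply: leq_trans (hK a d) _; apply: pol_mono; rewrite leq_add2l.
- by rewrite [catrev _ _]revK.
- by rewrite f6 ?/s5 ?update_neq ?s4N //; lia.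
- by rewrite f6 ?/s5 ?update_neq ?v4 //; lia.
- exact: v6.
exists s7, ((tree_size (s 0)).+1 + (t1 + ((tree_size (s1 0)).+1 + (2 + (t4 + ((tree_size (s4 N)).+1 + (t6 + t7))))))).
split.
- apply: exec_seq.
    exact: exec_assign s N (EVar 0).
  apply: exec_seq e1 _; apply: exec_seq (exec_assign _ _ _) _.
  apply: exec_seq (exec_assign s2 N.+1 ENil) _; apply: exec_seq e4 _.
  apply: exec_seq; last by apply: exec_seq e6 e7.
  exact: exec_assign s4 0 (EVar N).
- by rewrite v7 [catrev _ _]revK.
- move=> x xN; rewrite f7 ?f6 /s5 ?update_neq ?f4 /s3 ?update_neq /s2 ?update_neq ?f1 /s0 ?update_neq //; lia.
rewrite sa v1 s4N.
have L := hsz a; have L' := leq_trans (size_encode_seq (l a)) L.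
have b4' : t4 <= pol C3 D3 (tree_size (encode a)) * (4 * (pol C3 D3 (tree_size (encode a)) + 1) + 10).
  by apply: leq_trans b4 _; apply: leq_mul => //; rewrite /=; lia.
have b7' : t7 <= pol C3 D3 (tree_size (encode a)) * (tree_size (encode a) + 3 * pol C3 D3 (tree_size (encode a)) + pol C4 D4 (tree_size (encode a) + pol C3 D3 (tree_size (encode a))) + 20
     + pol C0 D0 (tree_size (encode a) + pol C3 D3 (tree_size (encode a)) + pol C4 D4 (tree_size (encode a) + pol C3 D3 (tree_size (encode a))) + 2)).
  apply: leq_trans b7 _; rewrite size_rev.
  have le4 : pol C4 D4 (tree_size (encode a) + tree_size (encode (l a))) <= pol C4 D4 (tree_size (encode a) + pol C3 D3 (tree_size (encode a))).
    by apply: pol_mono; rewrite leq_add2l.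
  apply: leq_mul => //; apply: leq_add; first lia.
  by apply: pol_mono; lia.
lia.
Qed.

(** * Closure properties of polynomial-time functions *)

Lemma encode_nat_inj : injective (encode : nat -> tree).
Proof. by elim=> [|m IH] [|n] //= [/IH ->]. Qed.

Lemma encode_pair_inj {A B} {eA : encodable A} {eB : encodable B} :
  injective (encode : A -> tree) -> injective (encode : B -> tree) ->
  injective (encode : A * B -> tree).
Proof. by move=> iA iB [a b] [c d] [/iA -> /iB ->]. Qed.

Lemma encode_seq_inj {A} {eA : encodable A} :
  injective (encode : A -> tree) -> injective (encode : seq A -> tree).
Proof. by move=> iA; elim=> [|a l IH] [|b l'] //= [/iA -> /IH ->]. Qed.

Lemma encode_nat_size n : tree_size (encode n) = (2 * n).+1.
Proof.
elim: n => // n IH.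
have -> : tree_size (encode n.+1) = (1 + tree_size (encode n)).+1 by [].
by rewrite IH; lia.
Qed.

Section Combinators.
Context {A B Z : Type} {eA : encodable A} {eB : encodable B} {eZ : encodable Z}.

Lemma ptime_fst (f : A -> B * Z) : ptime f -> ptime (fun a => (f a).1).
Proof.
by move=> hf; apply: (@ptime_expr _ _ _ _ _ _ (EHd (EVar 0)) f) => //= s a ->.
Qed.

Lemma ptime_snd (f : A -> B * Z) : ptime f -> ptime (fun a => (f a).2).
Proof.
by move=> hf; apply: (@ptime_expr _ _ _ _ _ _ (ETl (EVar 0)) f) => //= s a ->.
Qed.

Lemma ptime_encode (f : A -> B) : ptime f -> ptime (fun a => encode (f a)).
Proof. by move=> hf; apply: ptime_enc hf _. Qed.

Lemma ptime_Node (f g : A -> tree) :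
  ptime f -> ptime g -> ptime (fun a => Node (f a) (g a)).
Proof. by move=> hf hg; apply: ptime_enc (ptime_pair hf hg) _. Qed.

Lemma ptime_eq_encode (f g : A -> B) :
  ptime f -> ptime g -> ptime (fun a => encode (f a) == encode (g a)).
Proof.
move=> hf hg.
by apply: (ptime_expr (e := EEq (EHd (EVar 0)) (ETl (EVar 0))) _ (ptime_pair hf hg)) => //= s a ->.
Qed.

Lemma ptime_negb (f : A -> bool) : ptime f -> ptime (fun a => ~~ f a).
Proof.
move=> hf; apply: ptime_ext (ptime_if hf (ptime_const false) (ptime_const true)) _.
by move=> a; case: (f a).
Qed.

Lemma ptime_andb (f g : A -> bool) :
  ptime f -> ptime g -> ptime (fun a => f a && g a).
Proof.
move=> hf hg; apply: ptime_ext (ptime_if hf hg (ptime_const false)) _.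
by move=> a; case: (f a).
Qed.

Lemma ptime_orb (f g : A -> bool) :
  ptime f -> ptime g -> ptime (fun a => f a || g a).
Proof.
move=> hf hg; apply: ptime_ext (ptime_if hf (ptime_const true) hg) _.
by move=> a; case: (f a).
Qed.

Lemma ptime_cons (f : A -> B) (g : A -> seq B) :
  ptime f -> ptime g -> ptime (fun a => f a :: g a).
Proof. by move=> hf hg; apply: ptime_enc (ptime_pair hf hg) _. Qed.

Lemma ptime_behead (f : A -> seq B) : ptime f -> ptime (fun a => behead (f a)).
Proof.
move=> hf; apply: (@ptime_expr _ _ _ _ _ _ (ETl (EVar 0)) f) => //= s a ->.
by case: (f a).
Qed.

Lemma ptime_nilp (f : A -> seq B) : ptime f -> ptime (fun a => nilp (f a)).
Proof.
move=> hf; apply: (@ptime_expr _ _ _ _ _ _ (EEq (EVar 0) ENil) f) => //= s a ->.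
by case: (f a).
Qed.

Lemma ptime_tree_hd (f : A -> tree) :
  ptime f -> ptime (fun a => if f a is Node b _ then b else Leaf).
Proof.
by move=> hf; apply: (@ptime_expr _ _ _ _ _ _ (EHd (EVar 0)) f) => //= s a ->.
Qed.

Lemma ptime_tree_tl (f : A -> tree) :
  ptime f -> ptime (fun a => if f a is Node _ b then b else Leaf).
Proof.
by move=> hf; apply: (@ptime_expr _ _ _ _ _ _ (ETl (EVar 0)) f) => //= s a ->.
Qed.

Lemma ptime_succ (f : A -> nat) : ptime f -> ptime (fun a => (f a).+1).
Proof.
by move=> hf; apply: (@ptime_expr _ _ _ _ _ _ (ECons ENil (EVar 0)) f) => //= s a ->.
Qed.

Lemma ptime_pred (f : A -> nat) : ptime f -> ptime (fun a => (f a).-1).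
Proof.
move=> hf; apply: (@ptime_expr _ _ _ _ _ _ (ETl (EVar 0)) f) => //= s a ->.
by case: (f a).
Qed.

(** A unary number and a list of that many units have the same code. This turns bounded iteration
    into a fold. *)
Lemma ptime_nseq_tt (f : A -> nat) : ptime f -> ptime (fun a => nseq (f a) tt).
Proof.
by move=> hf; apply: ptime_enc hf _ => a; elim: (f a) => // n; rewrite /encode /= => ->.
Qed.

Lemma poly_bounded_pol2 (T : nat -> nat) (F : A -> B -> nat) :
  poly_bounded T ->
  (forall a b, F a b <= T (tree_size (encode a) + tree_size (encode b))) ->
  exists C D, forall a b, F a b <= pol C D (tree_size (encode a) + tree_size (encode b)).
Proof.
by move=> [C [D hT]] hF; exists C, D => a b; apply: leq_trans (hF a b) (hT _).
Qed.

End Combinators.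

Lemma ptime_eq {A} {eA : encodable A} {B : eqType} {eB : encodable B} (f g : A -> B) :
  injective (encode : B -> tree) -> ptime f -> ptime g -> ptime (fun a => f a == g a).
Proof.
move=> iB hf hg; apply: ptime_ext (ptime_eq_encode hf hg) _ => a.
by apply/eqP/eqP => [/iB|->].
Qed.

Lemma ptime_iter {A B} {eA : encodable A} {eB : encodable B}
    (n : A -> nat) (g : A -> B -> B) (x : A -> B) :
  ptime (fun p => g p.1 p.2) -> ptime n -> ptime x ->
  (exists C D, forall a k, tree_size (encode (iter k (g a) (x a))) <=
     pol C D (tree_size (encode a) + k)) ->
  ptime (fun a => iter (n a) (g a) (x a)).
Proof.
move=> hg hn hx [C [D hK]].
have E a d : foldr (fun (_ : unit) z => g a z) (x a) d = iter (size d) (g a) (x a).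
  by elim: d => //= _ d ->.
apply: (@ptime_ext _ _ _ _ (fun a => foldr (fun _ z => g a z) (x a) (nseq (n a) tt))).
  apply: (ptime_foldr (S := fun a _ z => g a z)) => //.
  - apply: (ptime_comp (f := fun p => (p.1.1, p.2)) (g := fun p => g p.1 p.2)) => //.
    apply: ptime_pair; last exact: ptime_snd ptime_id.
    exact: ptime_fst (ptime_fst ptime_id).
  - exact: ptime_nseq_tt.
  exists C, D => a d; rewrite E; apply: leq_trans (hK _ _) _.
  by apply: pol_mono; rewrite leq_add2l ltnW ?size_encode_seq.
by move=> a; rewrite E size_nseq.
Qed.

Lemma ptime_add {A} {eA : encodable A} (m n : A -> nat) :
  ptime m -> ptime n -> ptime (fun a => m a + n a).
Proof.
move=> hm hn; have [C [D hK]] := ptime_size hn.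
have E k j : iter k succn j = k + j by elim: k => //= k ->.
apply: (@ptime_ext _ _ _ _ (fun a => iter (m a) succn (n a))) => [|a]; last exact: E.
apply: (ptime_iter (g := fun _ => succn)) => //.
  by apply: ptime_succ; apply: ptime_snd ptime_id.
have [C' [D' h]] : poly_bounded (fun n => 2 * n + pol C D n) by poly_bound.
exists C', D' => a k; apply: leq_trans (h _).
have := hK a; rewrite E !encode_nat_size.
have hp : pol C D (tree_size (encode a)) <= pol C D (tree_size (encode a) + k).
  by apply: pol_mono; rewrite leq_addr.
lia.
Qed.

Lemma ptime_mul {A} {eA : encodable A} (m n : A -> nat) :
  ptime m -> ptime n -> ptime (fun a => m a * n a).
Proof.
move=> hm hn; have [C [D hK]] := ptime_size hn.
have E k j : iter k (addn j) 0 = k * j by elim: k => //= k ->; rewrite mulSn.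
apply: (@ptime_ext _ _ _ _ (fun a => iter (m a) (addn (n a)) 0)) => [|a]; last exact: E.
apply: (ptime_iter (g := fun a => addn (n a))) => //.
- apply: ptime_add; last exact: ptime_snd ptime_id.
  by apply: ptime_comp hn; apply: ptime_fst ptime_id.
- exact: ptime_const.
have [C' [D' h]] : poly_bounded (fun n => n * pol C D n + 1) by poly_bound.
exists C', D' => a k; apply: leq_trans (h _).
have := hK a; rewrite E !encode_nat_size => {}hK.
have hp : pol C D (tree_size (encode a)) <= pol C D (tree_size (encode a) + k).
  by apply: pol_mono; rewrite leq_addr.
nia.
Qed.

Lemma ptime_sub {A} {eA : encodable A} (m n : A -> nat) :
  ptime m -> ptime n -> ptime (fun a => m a - n a).
Proof.
move=> hm hn; have [C [D hK]] := ptime_size hm.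
have E k j : iter k predn j = j - k.
  by elim: k => [|k /= ->]; rewrite ?subn0 // subnS.
apply: (@ptime_ext _ _ _ _ (fun a => iter (n a) predn (m a))) => [|a]; last exact: E.
apply: (ptime_iter (g := fun _ => predn)) => //.
  by apply: ptime_pred; apply: ptime_snd ptime_id.
exists C, D => a k; have := hK a; rewrite E !encode_nat_size.
have hp : pol C D (tree_size (encode a)) <= pol C D (tree_size (encode a) + k).
  by apply: pol_mono; rewrite leq_addr.
lia.
Qed.

Lemma ptime_leq {A} {eA : encodable A} (m n : A -> nat) :
  ptime m -> ptime n -> ptime (fun a => m a <= n a).
Proof.
move=> hm hn; apply: ptime_eq encode_nat_inj _ (ptime_const _).
exact: ptime_sub.
Qed.

Lemma ptime_exp {A} {eA : encodable A} (m : A -> nat) n : ptime m -> ptime (fun a => m a ^ n).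
Proof.
move=> hm; elim: n => [|n IH]; first exact: ptime_const.
by apply: ptime_ext (ptime_mul hm IH) _ => a; rewrite expnS.
Qed.

Section Lists.
Context {A B Z : Type} {eA : encodable A} {eB : encodable B} {eZ : encodable Z}.

Lemma ptime_map (F : A -> B -> Z) (l : A -> seq B) :
  ptime (fun p => F p.1 p.2) -> ptime l -> ptime (fun a => map (F a) (l a)).
Proof.
move=> hF hl; have [C [D hK]] := ptime_size hF.
have E a d : foldr (fun h acc => F a h :: acc) [::] d = map (F a) d by elim: d => //= h d ->.
apply: (@ptime_ext _ _ _ _ (fun a => foldr (fun h acc => F a h :: acc) [::] (l a))) => [|a]; last exact: E.
apply: (ptime_foldr (S := fun a h acc => F a h :: acc)) hl _.
- apply: ptime_cons; last exact: ptime_snd ptime_id.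
  by apply: ptime_comp hF; apply: ptime_fst ptime_id.
- exact: ptime_const.
apply: (@poly_bounded_pol2 _ _ _ _ (fun n => n * (pol C D n).+1 + 1)); first by poly_bound.
move=> a d; rewrite E.
(* The argument of [pol] stays at M throughout the induction, so the bounds for the single elements
   just add up. *)
have : forall M, tree_size (encode d) <= M ->
  tree_size (encode (map (F a) d)) <= size d * (pol C D (tree_size (encode a) + M)).+1 + 1.
  elim: d => [|h d IH] M hM //; rewrite [map _ _]/= encode_cons_size [size _]/= mulSn.
  rewrite encode_cons_size in hM.
  have d_gt0 : 0 < tree_size (encode d) by apply: encode_gt0.
  have hp : pol C D (tree_size (encode a) + tree_size (encode h)).+1 <=
    pol C D (tree_size (encode a) + M) by apply: pol_mono; lia.
  by have := IH M; have := hK (a, h); rewrite encode_pair_size /=; lia.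
move/(_ _ (leqnn _)) => h; apply: leq_trans h _.
by rewrite leq_add2r leq_mul2r ltnW ?orbT // ltn_addl // size_encode_seq.
Qed.

Lemma ptime_cat (f g : A -> seq B) :
  ptime f -> ptime g -> ptime (fun a => f a ++ g a).
Proof.
move=> hf hg; have [C [D hK]] := ptime_size hg.
apply: (@ptime_ext _ _ _ _ (fun a => foldr cons (g a) (f a))) => [|a]; last first.
  by elim: (f a) => //= h l ->.
apply: (ptime_foldr (S := fun _ h acc => h :: acc)) hg hf _.
  apply: ptime_cons; last exact: ptime_snd ptime_id.
  exact: ptime_snd (ptime_fst ptime_id).
apply: (@poly_bounded_pol2 _ _ _ _ (fun n => n + pol C D n)); first by poly_bound.
move=> a d; apply: (@leq_trans (tree_size (encode d) + tree_size (encode (g a)))).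
  elim: d => [|h d IH]; first by rewrite leq_addl.
  by rewrite [foldr _ _ _]/= !encode_cons_size addSn ltnS -addnA leq_add2l.
apply: leq_add; first by rewrite leq_addl.
by apply: leq_trans (hK a) _; apply: pol_mono; rewrite leq_addr.
Qed.

Lemma ptime_size_seq (f : A -> seq B) : ptime f -> ptime (fun a => size (f a)).
Proof.
move=> hf; apply: (@ptime_ext _ _ _ _ (fun a => foldr (fun _ n => n.+1) 0 (f a))) => [|a]; last first.
  by elim: (f a) => //= h l ->.
apply: (ptime_foldr (S := fun _ _ n => n.+1)) => //.
- by apply: ptime_succ; apply: ptime_snd ptime_id.
- exact: ptime_const.
apply: (@poly_bounded_pol2 _ _ _ _ (fun n => 2 * n + 1)); first by poly_bound.
move=> a d; rewrite encode_nat_size.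
have -> : foldr (fun _ n => n.+1) 0 d = size d by elim: d => //= _ d ->.
have hd : size d < tree_size (encode d) by apply: size_encode_seq.
lia.
Qed.

Lemma ptime_all (P : A -> B -> bool) (l : A -> seq B) :
  ptime (fun p => P p.1 p.2) -> ptime l -> ptime (fun a => all (P a) (l a)).
Proof.
move=> hP hl; apply: (ptime_foldr (S := fun a h b => P a h && b)) hl _.
- apply: ptime_andb; last exact: ptime_snd ptime_id.
  by apply: ptime_comp hP; apply: ptime_fst ptime_id.
- exact: ptime_const.
by exists 3, 0 => a d; case: (foldr _ _ _).
Qed.

Lemma ptime_has (P : A -> B -> bool) (l : A -> seq B) :
  ptime (fun p => P p.1 p.2) -> ptime l -> ptime (fun a => has (P a) (l a)).
Proof.
move=> hP hl; apply: (ptime_foldr (S := fun a h b => P a h || b)) hl _.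
- apply: ptime_orb; last exact: ptime_snd ptime_id.
  by apply: ptime_comp hP; apply: ptime_fst ptime_id.
- exact: ptime_const.
by exists 3, 0 => a d; case: (foldr _ _ _).
Qed.

Lemma ptime_nth x0 (l : A -> seq B) (n : A -> nat) :
  ptime l -> ptime n -> ptime (fun a => nth x0 (l a) (n a)).
Proof.
move=> hl hn; have [C [D hK]] := ptime_size hl.
have hi : ptime (fun a => iter (n a) behead (l a)).
  apply: (ptime_iter (g := fun _ => behead)) => //.
    by apply: ptime_behead; apply: ptime_snd ptime_id.
  exists C, D => a k; apply: (@leq_trans (tree_size (encode (l a)))).
    elim: k => //= k IH; apply: leq_trans _ IH.
    by case: (iter k behead (l a)) => // h s; rewrite encode_cons_size [behead _]/=; lia.
  by apply: leq_trans (hK a) _; apply: pol_mono; rewrite leq_addr.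
apply: (@ptime_ext _ _ _ _ (fun a => head x0 (iter (n a) behead (l a)))) => [|a]; last first.
  elim: (n a) (l a) => [|k IH] s; first by case: s.
  by rewrite iterSr IH nth_behead.
apply: ptime_comp hi _.
(* On the empty list [EHd] returns [Leaf], which need not be the code of x0; so x0 is put in before
   the head is taken. *)
apply: (@ptime_ext _ _ _ _ (fun s : seq B => head x0 (if nilp s then [:: x0] else s))).
  have h : ptime (fun s : seq B => if nilp s then [:: x0] else s).
    apply: ptime_if (ptime_const _) ptime_id; exact: ptime_nilp ptime_id.
  apply: (@ptime_expr _ _ _ _ _ _ (EHd (EVar 0)) _ _ _ h) => //= s l' ->.
  by case: l'.
by case.
Qed.

End Lists.

Lemma encode_flatten_size {B} {eB : encodable B} (d : seq (seq B)) :
  tree_size (encode (flatten d)) <= tree_size (encode d).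
Proof.
elim: d => // h d IH; rewrite [flatten _]/= encode_cons_size.
elim: h => [|x h IHh]; first by rewrite [_ ++ _]/=; lia.
rewrite [_ ++ _]/= !encode_cons_size; lia.
Qed.

Lemma ptime_flatten {A B} {eA : encodable A} {eB : encodable B} (f : A -> seq (seq B)) :
  ptime f -> ptime (fun a => flatten (f a)).
Proof.
move=> hf; apply: (ptime_foldr (S := fun _ h acc => h ++ acc)) hf _.
- apply: ptime_cat; last exact: ptime_snd ptime_id.
  exact: ptime_snd (ptime_fst ptime_id).
- exact: ptime_const.
apply: (@poly_bounded_pol2 _ _ _ _ id) => [|a d]; first exact: poly_bounded_id.
by apply: leq_trans (encode_flatten_size d) _; rewrite leq_addl.
Qed.

Lemma ptime_mem {A} {eA : encodable A} {B : eqType} {eB : encodable B}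
    (x : A -> B) (l : A -> seq B) :
  injective (encode : B -> tree) -> ptime x -> ptime l -> ptime (fun a => x a \in l a).
Proof.
move=> iB hx hl; apply: (@ptime_ext _ _ _ _ (fun a => has (fun y => y == x a) (l a))).
  apply: (ptime_has (P := fun a y => y == x a)) hl.
  apply: ptime_eq iB (ptime_snd ptime_id) _.
  by apply: ptime_comp hx; apply: ptime_fst ptime_id.
by move=> a; rewrite has_pred1.
Qed.

(** A list is duplicate-free iff [undup] fixes it. Unlike [uniq], [undup] is a plain fold, since the
    accumulator has the same members as the tail. *)
Lemma ptime_uniq {A} {eA : encodable A} {B : eqType} {eB : encodable B} (l : A -> seq B) :
  injective (encode : B -> tree) -> ptime l -> ptime (fun a => uniq (l a)).
Proof.
move=> iB hl; apply: (@ptime_ext _ _ _ _ (fun a => undup (l a) == l a)) => [|a].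
  apply: (ptime_eq (encode_seq_inj iB) _ hl); apply: (ptime_comp hl).
  pose F (h : B) (acc : seq B) : seq B := if h \in acc then acc else h :: acc.
  have : ptime (foldr F [::]).
    apply: (ptime_foldr (A := seq B) (S := fun _ => F)
      (z := fun=> [::]) _ (ptime_const _) ptime_id).
      have h1 : ptime (fun p : seq B * B * seq B => p.1.2) by exact: ptime_snd (ptime_fst ptime_id).
      have h2 : ptime (fun p : seq B * B * seq B => p.2) by exact: ptime_snd ptime_id.
      exact: (ptime_if (ptime_mem iB h1 h2) h2 (ptime_cons h1 h2)).
    apply: (@poly_bounded_pol2 _ _ _ _ id) => [|a d]; first exact: poly_bounded_id.
    apply: (@leq_trans (tree_size (encode d))); last by rewrite leq_addl.
    elim: d => // h d IH; rewrite [foldr _ _ _]/= encode_cons_size.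
    set acc := foldr F [::] d in IH *.
    by rewrite /F; case: ifP => _; rewrite ?encode_cons_size; lia.
  by move/ptime_ext; apply; elim=> //= h d ->; rewrite /F mem_undup.
by apply/eqP/idP => [<-|/undup_id //]; apply: undup_uniq.
Qed.

Lemma ptime_iota0 {A} {eA : encodable A} (n : A -> nat) :
  ptime n -> ptime (fun a => iota 0 (n a)).
Proof.
move=> hn; apply: ptime_comp hn _.
have E k : iter k (fun s => 0 :: map succn s) [::] = iota 0 k.
  by elim: k => //= k ->; rewrite -(iotaDl 1).
apply: (@ptime_ext _ _ _ _ (fun n => iter n (fun s => 0 :: map succn s) [::])) => [|a]; last exact: E.
apply: (ptime_iter (g := fun _ s => 0 :: map succn s)) ptime_id (ptime_const _) _.
  apply: ptime_cons; first exact: ptime_const.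
  apply: (ptime_map (F := fun _ => succn)); last exact: ptime_snd ptime_id.
  by apply: ptime_succ; apply: ptime_snd ptime_id.
have [C [D h]] : poly_bounded (fun n => n * (2 * n + 2) + 1) by poly_bound.
exists C, D => a k; apply: leq_trans (h _); rewrite E.
have : forall i, tree_size (encode (iota i k)) <= k * (2 * (i + k) + 2) + 1.
  elim: k => // k IH i; rewrite [iota _ _]/= encode_cons_size encode_nat_size.
  by have := IH i.+1; nia.
move/(_ 0); nia.
Qed.

(** * Programs for the reduction *)

Fixpoint children (x : tree) : seq tree :=
  if x is Node a b then a :: children b else [::].

(** The code of a list of trees is the tree with these trees along its right spine, so taking
    [children] requires no computation. *)
Lemma encode_children x : encode (children x) = x.
Proof. by elim: x => // a _ b IH; rewrite -[in RHS]IH. Qed.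

Definition tree_hd (x : tree) : tree := if x is Node a _ then a else Leaf.
Definition tree_tl (x : tree) : tree := if x is Node _ b then b else Leaf.

(* The decoders are total; x is a valid code iff re-encoding the decoded value
   gives x back. *)
Definition dec_nat (x : tree) : nat := size (children x).
Definition dec_nats (x : tree) : seq nat := [seq dec_nat y | y <- children x].

Definition dec_gate (x : tree) : gate :=
  if tree_hd x == encode 0 then GInput
  else if tree_hd x == encode 1 then GNot (dec_nat (tree_tl x))
  else if tree_hd x == encode 2 then GAnd (dec_nats (tree_tl x))
  else GOr (dec_nats (tree_tl x)).

Definition dec_circuit (x : tree) : seq gate := [seq dec_gate y | y <- children x].

Lemma children_seq A (enc : A -> tree) s : children (enc_seq enc s) = map enc s.
Proof. by elim: s => //= a s ->. Qed.

Lemma enc_natK : cancel enc_nat dec_nat.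
Proof. by rewrite /dec_nat; elim=> //= n ->. Qed.

Lemma enc_natsK : cancel (enc_seq enc_nat) dec_nats.
Proof. by move=> s; rewrite /dec_nats children_seq mapK //; apply: enc_natK. Qed.

Lemma enc_gateK : cancel enc_gate dec_gate.
Proof. by case=> [|i|s|s]; rewrite /dec_gate //= ?enc_natK ?enc_natsK. Qed.

Lemma enc_circuitK : cancel (enc_seq enc_gate) dec_circuit.
Proof. by move=> s; rewrite /dec_circuit children_seq mapK //; apply: enc_gateK. Qed.

(** A hook for [ptime_step], redefined whenever further operations have been shown to be
    polynomial-time. *)
Ltac ptime_extra := fail.
Ltac ptime_step :=
  first
  [ simple eapply ptime_const | simple eapply ptime_id | simple eapply encode_nat_inj | ptime_extra
  | simple eapply ptime_fst | simple eapply ptime_snd | simple eapply ptime_pair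
  | simple eapply ptime_if | simple eapply ptime_negb | simple eapply ptime_andb | simple eapply ptime_orb
  | simple eapply ptime_succ | simple eapply ptime_pred | simple eapply ptime_add | simple eapply ptime_mul
  | simple eapply ptime_sub | simple eapply ptime_leq | simple eapply ptime_cons | simple eapply ptime_nilp
  | simple eapply ptime_cat | simple eapply ptime_flatten | simple eapply ptime_size_seq
  | simple eapply ptime_map | simple eapply ptime_all | simple eapply ptime_has | simple eapply ptime_nth
  | simple eapply ptime_iota0 | simple eapply ptime_uniq | simple eapply ptime_mem | simple eapply ptime_eq
  | simple eapply ptime_encode | simple eapply ptime_Node ].
Ltac solve_ptime := repeat ptime_step.

Section Decoding.
Context {A : Type} {eA : encodable A}.

Lemma ptime_children (f : A -> tree) : ptime f -> ptime (fun a => children (f a)).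
Proof.
by move=> hf; apply: ptime_enc hf _ => a; rewrite encode_children.
Qed.

Lemma ptime_hd (f : A -> tree) : ptime f -> ptime (fun a => tree_hd (f a)).
Proof. exact: ptime_tree_hd. Qed.

Lemma ptime_tl (f : A -> tree) : ptime f -> ptime (fun a => tree_tl (f a)).
Proof. exact: ptime_tree_tl. Qed.

Lemma ptime_dec_nat (f : A -> tree) : ptime f -> ptime (fun a => dec_nat (f a)).
Proof. by move=> hf; apply: ptime_size_seq; apply: ptime_children. Qed.

Lemma ptime_GNot (f : A -> nat) : ptime f -> ptime (fun a => GNot (f a)).
Proof. by move=> hf; apply: ptime_enc (ptime_pair (ptime_const 1) hf) _. Qed.

Lemma ptime_GAnd (f : A -> seq nat) : ptime f -> ptime (fun a => GAnd (f a)).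
Proof. by move=> hf; apply: ptime_enc (ptime_pair (ptime_const 2) hf) _. Qed.

Lemma ptime_GOr (f : A -> seq nat) : ptime f -> ptime (fun a => GOr (f a)).
Proof. by move=> hf; apply: ptime_enc (ptime_pair (ptime_const 3) hf) _. Qed.

End Decoding.

Lemma ptime_dec_nats {A} {eA : encodable A} (f : A -> tree) :
  ptime f -> ptime (fun a => dec_nats (f a)).
Proof.
move=> hf; apply: (ptime_map (F := fun _ y => dec_nat y)).
  by apply: ptime_dec_nat; solve_ptime.
exact: ptime_children.
Qed.

Lemma encode_tree_inj : injective (encode : tree -> tree).
Proof. by []. Qed.

Ltac ptime_extra ::=
  first [ simple eapply encode_tree_inj | match goal with H : _ |- _ => simple eapply H end
  | simple eapply ptime_children | simple eapply ptime_hd | simple eapply ptime_tl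
  | simple eapply ptime_dec_nat | simple eapply ptime_dec_nats
  | simple eapply ptime_GNot | simple eapply ptime_GAnd | simple eapply ptime_GOr ].

Lemma ptime_dec_circuit {A} {eA : encodable A} (f : A -> tree) :
  ptime f -> ptime (fun a => dec_circuit (f a)).
Proof. by move=> hf; rewrite /dec_circuit /dec_gate; solve_ptime. Qed.

Definition is_not (g : gate) : bool := if g is GNot _ then true else false.
Definition is_and (g : gate) : bool := if g is GAnd _ then true else false.

Definition dec_preds (x : tree) : seq nat :=
  if tree_hd x == encode 0 then [::]
  else if tree_hd x == encode 1 then [:: dec_nat (tree_tl x)]
  else dec_nats (tree_tl x).

Section Gates.
Context {A : Type} {eA : encodable A} (g : A -> gate) (hg : ptime g).

Let hgt : ptime (fun a => encode (g a)). Proof. exact: ptime_encode. Qed.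

(** A program cannot match on a gate; here and below it inspects the tag at the head of the code. *)
Lemma ptime_is_input : ptime (fun a => is_input (g a)).
Proof.
apply: (@ptime_ext _ _ _ _ (fun a => tree_hd (encode (g a)) == encode 0)) => [|a].
  by solve_ptime.
by case: (g a).
Qed.

Lemma ptime_is_not : ptime (fun a => is_not (g a)).
Proof.
apply: (@ptime_ext _ _ _ _ (fun a => tree_hd (encode (g a)) == encode 1)) => [|a].
  by solve_ptime.
by case: (g a).
Qed.

Lemma ptime_is_and : ptime (fun a => is_and (g a)).
Proof.
apply: (@ptime_ext _ _ _ _ (fun a => tree_hd (encode (g a)) == encode 2)) => [|a].
  by solve_ptime.
by case: (g a).
Qed.

Lemma ptime_preds : ptime (fun a => preds (g a)).
Proof.
apply: (@ptime_ext _ _ _ _ (fun a => dec_preds (encode (g a)))) => [|a].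
  by rewrite /dec_preds; solve_ptime.
by case: (g a) => //= [i|s|s]; rewrite /dec_preds /= ?enc_natK ?enc_natsK.
Qed.

End Gates.

Ltac ptime_extra ::=
  first [ simple eapply encode_tree_inj | match goal with H : _ |- _ => simple eapply H end
  | simple eapply ptime_children | simple eapply ptime_hd | simple eapply ptime_tl
  | simple eapply ptime_dec_nat | simple eapply ptime_dec_nats | simple eapply ptime_dec_circuit
  | simple eapply ptime_GNot | simple eapply ptime_GAnd | simple eapply ptime_GOr
  | simple eapply ptime_is_input | simple eapply ptime_is_not | simple eapply ptime_is_and
  | simple eapply ptime_preds ].

Lemma ptime_circuit_wf : ptime (fun C : seq gate => circuit_wf C).
Proof.
apply: (@ptime_ext _ _ _ _ (fun C : seq gate => all (fun j =>
  let g := nth GInput C j in [&& uniq (preds g), all (fun i => i < j) (preds g) &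
    is_input g || is_not g || (1 < size (preds g))]) (iota 0 (size C)))).
  by solve_ptime.
by move=> C; apply: eq_all => j; rewrite /gate_wf /node; case: nth.
Qed.

Lemma ptime_is_output : ptime (fun p : seq gate * nat => is_output p.1 p.2).
Proof. by rewrite /is_output; solve_ptime. Qed.

(* Every backward path from node j has at most l edges and at most w large
   gates. *)
Fixpoint shallow (l w : nat) (C : seq gate) (j : nat) : bool :=
  let ps := preds (node C j) in
  let rec w' := if l is l'.+1 then all (shallow l' w' C) ps else nilp ps in
  if large (node C j) then (0 < w) && rec w.-1 else rec w.

(** Both l and w are fixed, so the recursion unrolls into l nested [all] loops; program and
    polynomial may depend on l. *)
Lemma ptime_shallow l w : ptime (fun p : seq gate * nat => shallow l w p.1 p.2).
Proof.
elim: l w => [|l IH] w; rewrite /= /large /node.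
  by solve_ptime.
have h w' : ptime (fun p : seq gate * nat => all (shallow l w' p.1) (preds (nth GInput p.1 p.2))).
  apply: ptime_all; last by solve_ptime.
  by apply: (ptime_comp (f := fun p : (seq gate * nat) * nat => (p.1.1, p.2)) _ (IH w')); solve_ptime.
by solve_ptime.
Qed.

(** De Morgan: a NAND of the values gives NOT, or the negation of AND, while a NAND of the negations
    gives OR. So gate 3 j has the value of node j, negated if j is an AND; the next gate then
    repeats the same NAND for an AND and negates gate 3 j otherwise. An input becomes a source. *)
Definition first_preds (g : gate) : seq nat :=
  if is_and g || is_not g then [seq (3 * i).+2 | i <- preds g]
  else [seq (3 * i).+1 | i <- preds g].

Definition second_preds (j : nat) (g : gate) : seq nat :=
  if is_and g then first_preds g else [:: 3 * j].

(* Node j of the circuit becomes the NAND gates 3 j, 3 j + 1 and 3 j + 2, the last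
   two of which compute the negation of j and j itself; the last gate, 3 n,
   computes the output. *)
Definition nand_nodes (C : seq gate) (o : nat) : seq (nat * seq nat) :=
  flatten [seq [:: (3 * j, first_preds (node C j));
                   ((3 * j).+1, second_preds j (node C j));
                   ((3 * j).+2, [:: (3 * j).+1])] | j <- iota 0 (size C)]
  ++ [:: (3 * size C, [:: (3 * o).+1])].

Notation vertex := (nat * (nat * seq nat))%type.

Definition vertices (C : seq gate) (o : nat) : seq vertex :=
  flatten [seq [seq (c, x) | x <- nand_nodes C o] | c <- [:: 0; 1; 2]].

(* A vertex (c, (i, ps)) stands for gate i with in-neighbours ps; it is A_i if
   c = 0 and one of the twins over i if c is 1 or 2. *)
Definition adj (v w : vertex) : bool :=
  (v.1 == 0) && (if w.1 == 0 then v.2.1 \in w.2.2 else v.2.1 <= w.2.1).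

Section Vectors.
Variables (T : eqType) (e : rel T) (V : seq T).

Definition coords : seq (T * T) := flatten [seq [seq (a, b) | b <- V] | a <- V].

(* For distinct v and w, the coordinates of the pair (a, b) contribute
   [v = a] + [w = a] + [v = b] + [w = b] to the Hamming distance, minus 2 if
   {a, b} = {v, w} and e a b.  Hence the distance is 4 |V| - 2 (e v w + e w v). *)
Definition bits (v : T) (c : T * T) : seq bool :=
  [:: (v == c.1) || e c.1 c.2 && (v == c.2); ~~ e c.1 c.2 && (v == c.2)].

Definition vec (v : T) : seq bool := flatten [seq bits v c | c <- coords].

Definition dimension : nat := 2 * (size V * size V).
Definition radius : nat := 4 * size V - 2.

End Vectors.

Lemma encode_vertex_inj : injective (encode : vertex -> tree).
Proof.
apply: encode_pair_inj; first exact: encode_nat_inj.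
apply: encode_pair_inj; first exact: encode_nat_inj.
by apply: encode_seq_inj; apply: encode_nat_inj.
Qed.

Lemma ptime_vertices : ptime (fun p : seq gate * nat => vertices p.1 p.2).
Proof.
by rewrite /vertices /nand_nodes /second_preds /first_preds /node; solve_ptime.
Qed.

Lemma ptime_vecs : ptime (fun V : seq vertex => [seq vec adj V v | v <- V]).
Proof.
have hinj := encode_vertex_inj.
by rewrite /vec /coords /bits /adj; solve_ptime.
Qed.

(** * Programs that write formulas *)

Section Formulas.
Context {A : Type} {eA : encodable A}.

Lemma ptime_enc_nat (f : A -> nat) : ptime f -> ptime (fun a => enc_nat (f a)).
Proof. by move=> hf; apply: ptime_enc hf _. Qed.

(** Since [encode] stores a formula with its length, the program F has to produce both components;
    the same holds for the other constructors. *)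
Lemma ptime_FAdj (f g : A -> nat) :
  ptime f -> ptime g -> ptime (fun a => FAdj (f a) (g a)).
Proof.
move=> hf hg; have hn := ptime_enc_nat; pose F a := (Node (enc_nat 0) (Node (enc_nat (f a)) (enc_nat (g a))), 3).
by apply: (@ptime_enc _ _ _ _ _ _ F); rewrite /F; solve_ptime.
Qed.

Lemma ptime_FEq (f g : A -> nat) :
  ptime f -> ptime g -> ptime (fun a => FEq (f a) (g a)).
Proof.
move=> hf hg; have hn := ptime_enc_nat; pose F a := (Node (enc_nat 1) (Node (enc_nat (f a)) (enc_nat (g a))), 3).
by apply: (@ptime_enc _ _ _ _ _ _ F); rewrite /F; solve_ptime.
Qed.

Lemma ptime_enc_fo (f : A -> fo) : ptime f -> ptime (fun a => enc_fo (f a)).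
Proof. by move=> hf; apply: ptime_hd (ptime_encode hf). Qed.

Lemma ptime_fo_length (f : A -> fo) : ptime f -> ptime (fun a => fo_length (f a)).
Proof. by move=> hf; apply: ptime_enc (ptime_tl (ptime_encode hf)) _. Qed.

Lemma ptime_FNot (f : A -> fo) : ptime f -> ptime (fun a => FNot (f a)).
Proof.
move=> hf; have h1 := ptime_enc_fo hf; have h2 := ptime_fo_length hf.
have hn := ptime_enc_nat; pose F a := (Node (enc_nat 2) (enc_fo (f a)), (fo_length (f a)).+1).
by apply: (@ptime_enc _ _ _ _ _ _ F); rewrite /F; solve_ptime.
Qed.

Lemma ptime_FAnd (f g : A -> fo) :
  ptime f -> ptime g -> ptime (fun a => FAnd (f a) (g a)).
Proof.
move=> hf hg; have h1 := ptime_enc_fo hf; have h2 := ptime_fo_length hf.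
have h3 := ptime_enc_fo hg; have h4 := ptime_fo_length hg.
have hn := ptime_enc_nat; pose F a := (Node (enc_nat 3) (Node (enc_fo (f a)) (enc_fo (g a))),
  (fo_length (f a) + fo_length (g a)).+1).
by apply: (@ptime_enc _ _ _ _ _ _ F); rewrite /F; solve_ptime.
Qed.

Lemma ptime_FOr (f g : A -> fo) :
  ptime f -> ptime g -> ptime (fun a => FOr (f a) (g a)).
Proof.
move=> hf hg; have h1 := ptime_enc_fo hf; have h2 := ptime_fo_length hf.
have h3 := ptime_enc_fo hg; have h4 := ptime_fo_length hg.
have hn := ptime_enc_nat; pose F a := (Node (enc_nat 4) (Node (enc_fo (f a)) (enc_fo (g a))),
  (fo_length (f a) + fo_length (g a)).+1).
by apply: (@ptime_enc _ _ _ _ _ _ F); rewrite /F; solve_ptime.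
Qed.

Lemma ptime_FEx (x : A -> nat) (f : A -> fo) :
  ptime x -> ptime f -> ptime (fun a => FEx (x a) (f a)).
Proof.
move=> hx hf; have h1 := ptime_enc_fo hf; have h2 := ptime_fo_length hf.
have hn := ptime_enc_nat; pose F a := (Node (enc_nat 5) (Node (enc_nat (x a)) (enc_fo (f a))), (fo_length (f a)).+2).
by apply: (@ptime_enc _ _ _ _ _ _ F); rewrite /F; solve_ptime.
Qed.

Lemma ptime_FAll (x : A -> nat) (f : A -> fo) :
  ptime x -> ptime f -> ptime (fun a => FAll (x a) (f a)).
Proof.
move=> hx hf; have h1 := ptime_enc_fo hf; have h2 := ptime_fo_length hf.
have hn := ptime_enc_nat; pose F a := (Node (enc_nat 6) (Node (enc_nat (x a)) (enc_fo (f a))), (fo_length (f a)).+2).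
by apply: (@ptime_enc _ _ _ _ _ _ F); rewrite /F; solve_ptime.
Qed.

End Formulas.

(** If a step enlarges the accumulator by an amount that does not depend on it, the total growth is
    at most the number of steps times that amount. Folds that build formulas are of this kind. *)
Lemma ptime_foldr_add {A B Z} {eA : encodable A} {eB : encodable B} {eZ : encodable Z}
    (S : A -> B -> Z -> Z) (z : A -> Z) (l : A -> seq B) C D :
  (forall a h y, tree_size (encode (S a h y)) <=
     tree_size (encode y) + pol C D (tree_size (encode a) + tree_size (encode h))) ->
  ptime (fun p : (A * B) * Z => S p.1.1 p.1.2 p.2) -> ptime z -> ptime l ->
  ptime (fun a => foldr (S a) (z a) (l a)).
Proof.
move=> hK hS hz hl; have [C' [D' hz']] := ptime_size hz.
apply: ptime_foldr => //.
apply: (@poly_bounded_pol2 _ _ _ _ (fun n => pol C' D' n + n * pol C D n)); first by poly_bound.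
move=> a d.
have : forall M, tree_size (encode d) <= M ->
  tree_size (encode (foldr (S a) (z a) d)) <= pol C' D' (tree_size (encode a)) +
    size d * pol C D (tree_size (encode a) + M).
  elim: d => [|h d IH] M hM; first by rewrite [size _]/= mul0n addn0; apply: hz'.
  rewrite encode_cons_size in hM; rewrite [foldr _ _ _]/= [size _]/= mulSn.
  have hp : pol C D (tree_size (encode a) + tree_size (encode h)) <=
    pol C D (tree_size (encode a) + M) by apply: pol_mono; lia.
  by have := IH M; have := hK a h (foldr (S a) (z a) d); lia.
move/(_ _ (leqnn _)) => h; apply: leq_trans h _; apply: leq_add.
  by apply: pol_mono; rewrite leq_addr.
have hd : size d < tree_size (encode d) by apply: size_encode_seq.
by rewrite leq_mul2r; apply/orP; right; lia.
Qed.

Section BigFormulas.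
Context {A B : Type} {eA : encodable A} {eB : encodable B}.

Lemma encode_fo_size phi :
  tree_size (encode phi) = (tree_size (enc_fo phi) + (2 * fo_length phi).+1).+1.
Proof. by rewrite -encode_nat_size. Qed.

Lemma encode_FOr_size f g :
  tree_size (encode (FOr f g)) <= tree_size (encode f) + tree_size (encode g) + 20.
Proof. by rewrite !encode_fo_size /=; lia. Qed.

Lemma encode_FAnd_size f g :
  tree_size (encode (FAnd f g)) <= tree_size (encode f) + tree_size (encode g) + 20.
Proof. by rewrite !encode_fo_size /=; lia. Qed.

Lemma ptime_foldr_FOr (F : A -> B -> fo) (z : A -> fo) (l : A -> seq B) :
  ptime (fun p => F p.1 p.2) -> ptime z -> ptime l ->
  ptime (fun a => foldr (fun h f => FOr (F a h) f) (z a) (l a)).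
Proof.
move=> hF; have [C [D hK]] := ptime_size hF.
have [C' [D' h]] : poly_bounded (fun n => pol C D n.+1 + 20) by poly_bound.
apply: (ptime_foldr_add (S := fun a h f => FOr (F a h) f) (C := C') (D := D')).
  move=> a b y; apply: leq_trans (encode_FOr_size _ _) _.
  apply: leq_trans (leq_add (leqnn _) (h _)).
  by have := hK (a, b); rewrite encode_pair_size /=; lia.
apply: ptime_FOr; last by solve_ptime.
by apply: (ptime_comp (f := fun p : A * B * fo => p.1)) hF; solve_ptime.
Qed.

Lemma ptime_foldr_FAnd (F : A -> B -> fo) (z : A -> fo) (l : A -> seq B) :
  ptime (fun p => F p.1 p.2) -> ptime z -> ptime l ->
  ptime (fun a => foldr (fun h f => FAnd (F a h) f) (z a) (l a)).
Proof.
move=> hF; have [C [D hK]] := ptime_size hF.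
have [C' [D' h]] : poly_bounded (fun n => pol C D n.+1 + 20) by poly_bound.
apply: (ptime_foldr_add (S := fun a h f => FAnd (F a h) f) (C := C') (D := D')).
  move=> a b y; apply: leq_trans (encode_FAnd_size _ _) _.
  apply: leq_trans (leq_add (leqnn _) (h _)).
  by have := hK (a, b); rewrite encode_pair_size /=; lia.
apply: ptime_FAnd; last by solve_ptime.
by apply: (ptime_comp (f := fun p : A * B * fo => p.1)) hF; solve_ptime.
Qed.

Lemma ptime_foldr_FEx (z : A -> fo) (l : A -> seq nat) :
  ptime z -> ptime l -> ptime (fun a => foldr FEx (z a) (l a)).
Proof.
have [C [D h]] : poly_bounded (fun n => n + 20) by poly_bound.
apply: (ptime_foldr_add (S := fun a => FEx) (C := C) (D := D)) => [a x y|].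
  apply: leq_trans (leq_add (leqnn _) (h _)).
  rewrite !encode_fo_size encode_nat_size /= -[tree_size (enc_nat x)]/(tree_size (encode x)) encode_nat_size; lia.
by apply: ptime_FEx; solve_ptime.
Qed.

End BigFormulas.

(** * Formulas over the graph of a NAND network *)

Definition fIff (f g : fo) : fo := FOr (FAnd f g) (FAnd (FNot f) (FNot g)).

Definition fTwin (x : nat) : fo :=
  FEx 0 (FAnd (FNot (FEq x 0)) (FAll 1 (fIff (FAdj x 1) (FAdj 0 1)))).

(** A_x is adjacent to exactly the twins over positions at least x, so x < y iff some twin sees A_x
    but not A_y. *)
Definition fLess (x y : nat) : fo :=
  FEx 2 (FAnd (fTwin 2) (FAnd (FAdj x 2) (FNot (FAdj y 2)))).

Definition fPred (z y : nat) : fo :=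
  FAnd (FNot (fTwin z)) (FAnd (FAdj z y) (fLess z y)).

Definition fSource (y : nat) : fo := FAll 3 (FNot (fPred 3 y)).

(** The gate added at the end of the network is the maximum of the order; in this way the formula
    finds the output without any constant. *)
Definition fLast (y : nat) : fo :=
  FAnd (FNot (fTwin y)) (FAll 3 (FOr (fTwin 3) (FNot (fLess y 3)))).

Definition fIn (X : seq nat) (y : nat) : fo :=
  foldr (fun x f => FOr (FEq y x) f) (FNot (FEq y y)) X.

(* The node to be evaluated is the value of variable 4 + l; variables below 4 are
   used by the auxiliary formulas. *)
Fixpoint fVal (X : seq nat) (l : nat) : fo :=
  if l is l'.+1 then
    FOr (fIn X l'.+1.+4)
        (FEx l'.+4 (FAnd (fPred l'.+4 l'.+1.+4) (FNot (fVal X l'))))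
  else fIn X 4.

(** On the diagonal a trivially true formula takes the place of the inequality, so that the same
    list X serves for every x. *)
Definition fDistinct (X : seq nat) (x : nat) : fo :=
  foldr (fun y f => FAnd (if x == y then FEq x x else FNot (FEq x y)) f)
    (FAnd (FNot (fTwin x)) (fSource x)) X.

Definition fBody (X : seq nat) (L : nat) : fo :=
  foldr (fun x f => FAnd (fDistinct X x) f)
    (FEx L.+4 (FAnd (fLast L.+4) (fVal X L))) X.

(** The chosen inputs are the variables from L + 5 on, because the evaluation occupies those up to L
    + 4. *)
Definition fSat (L k : nat) : fo :=
  let X := [seq L.+1.+4 + i | i <- iota 0 k] in foldr FEx (fBody X L) X.

Lemma fo_sat_ext V (E : V -> V -> Prop) phi a b :
  a =1 b -> fo_sat E a phi <-> fo_sat E b phi.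
Proof.
elim: phi a b => [x y|x y|f IH|f IHf g IHg|f IHf g IHg|x f IH|x f IH] a b ab /=;
  rewrite ?ab //.
- by rewrite (IH a b ab).
- by rewrite (IHf a b ab) (IHg a b ab).
- by rewrite (IHf a b ab) (IHg a b ab).
- have h v : fo_sat E (update a x v) f <-> fo_sat E (update b x v) f.
    by apply: IH => y; rewrite /update ab.
  by split=> [[v /h ?]|[v /h ?]]; exists v.
have h v : fo_sat E (update a x v) f <-> fo_sat E (update b x v) f.
  by apply: IH => y; rewrite /update ab.
by split=> H v; apply/h.
Qed.

Lemma fo_sat_iso V1 V2 (E1 : V1 -> V1 -> Prop) (E2 : V2 -> V2 -> Prop) (h : V1 -> V2) phi a :
  injective h -> (forall w, exists v, h v = w) ->
  (forall u v, E1 u v <-> E2 (h u) (h v)) ->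
  fo_sat E1 a phi <-> fo_sat E2 (h \o a) phi.
Proof.
move=> h_inj h_sur hE.
have hu (b : nat -> V1) x v phi' : fo_sat E2 (h \o update b x v) phi' <-> fo_sat E2 (update (h \o b) x (h v)) phi'.
  by apply: fo_sat_ext => y; rewrite /update /=; case: eqP.
elim: phi a => [x y|x y|f IH|f IHf g IHg|f IHf g IHg|x f IH|x f IH] a /=.
- exact: hE.
- by split=> [->|/h_inj].
- by rewrite IH.
- by rewrite IHf IHg.
- by rewrite IHf IHg.
- split=> [[v /IH/hu ?]|[w]]; first by exists (h v).
  by have [v <- /hu/IH] := h_sur w; exists v.
split=> H; first by move=> w; have [v <-] := h_sur w; apply/hu/IH.
by move=> v; apply/IH/hu.
Qed.

Lemma fo_sat_foldr_FEx V (E : V -> V -> Prop) X f a :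
  fo_sat E a (foldr FEx f X) <->
  exists2 e, (forall y, y \notin X -> e y = a y) & fo_sat E e f.
Proof.
elim: X a => [|x X IH] a /=.
  split=> [h|[e ea]]; first by exists a.
  by apply: (proj1 (fo_sat_ext _ _ _)) => y; apply: ea.
split=> [[v /IH [e ea h]]|[e ea h]].
  exists e => // y; rewrite inE negb_or => /andP[yx /ea ->].
  by rewrite update_neq.
exists (e x); apply/IH; exists e => // y yX; rewrite /update.
by case: eqP => [->//|/eqP yx]; rewrite ea // inE negb_or yx.
Qed.

Lemma fo_sat_foldr_FAnd V (E : V -> V -> Prop) (F : nat -> fo) X f a :
  fo_sat E a (foldr (fun x g => FAnd (F x) g) f X) <->
  (forall x, x \in X -> fo_sat E a (F x)) /\ fo_sat E a f.
Proof.
elim: X => [|x X IH] /=; first by split=> [|[]].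
rewrite IH; split=> [[hx [hX hf]]|[hX hf]].
  by split=> // y; rewrite inE => /predU1P[->|/hX].
by split; [|split=> // y yX]; apply: hX; rewrite inE ?eqxx ?yX ?orbT.
Qed.

Lemma fo_sat_fIn V (E : V -> V -> Prop) X y a :
  fo_sat E a (fIn X y) <-> exists2 x, x \in X & a y = a x.
Proof.
elim: X => [|x X IH] /=; first by split=> [[]|[]].
rewrite IH; split=> [[h|[z zX h]]|[z]].
- by exists x; rewrite ?mem_head.
- by exists z; rewrite // inE zX orbT.
by rewrite inE => /predU1P[->|zX] h; [left | right; exists z].
Qed.

(** * The meaning of the formulas in the graph of a network *)

Section NandGraph.

Variables (m : nat) (P : nat -> seq nat).
Hypothesis P_lt : forall i j, i < m -> j \in P i -> j < i.

Definition nand_vertices : seq vertex :=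
  flatten [seq [seq (c, (i, P i)) | i <- iota 0 m] | c <- [:: 0; 1; 2]].

Definition nand_vertex : Type := {v : vertex | v \in nand_vertices}.

Definition nand_edge (v w : nand_vertex) : Prop :=
  sval v <> sval w /\ adj (sval v) (sval w) || adj (sval w) (sval v).

Definition kind (v : nand_vertex) : nat := (sval v).1.
Definition pos (v : nand_vertex) : nat := (sval v).2.1.

Lemma mem_nand_vertices v :
  (v \in nand_vertices) = [&& v.1 < 3, v.2.1 < m & v.2.2 == P v.2.1].
Proof.
case: v => c [i p] /=; apply/flatten_mapP/and3P => [[c' hc' /mapP[j]]|[hc hi /eqP ->]].
  rewrite mem_iota => hj [-> -> ->]; split=> //.
  by move: hc'; rewrite !inE => /or3P[] /eqP ->.
exists c; first by case: c hc => [|[|[|c]]].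
by apply/mapP; exists i; rewrite ?mem_iota.
Qed.

Lemma kind_lt v : kind v < 3.
Proof. by have := svalP v; rewrite mem_nand_vertices => /and3P[]. Qed.

Lemma pos_lt v : pos v < m.
Proof. by have := svalP v; rewrite mem_nand_vertices => /and3P[]. Qed.

Lemma svalE v : sval v = (kind v, (pos v, P (pos v))).
Proof.
have := svalP v; rewrite mem_nand_vertices => /and3P[_ _ /eqP <-].
by case: v => [[c [i p]] h].
Qed.

Lemma nand_vertex_inj v w : kind v = kind w -> pos v = pos w -> v = w.
Proof. by move=> hk hi; apply: val_inj; rewrite /= !svalE hk hi. Qed.

Lemma nand_vertex_ex c i : c < 3 -> i < m -> exists v, kind v = c /\ pos v = i.
Proof.
move=> hc hi; have hv : (c, (i, P i)) \in nand_vertices.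
  by rewrite mem_nand_vertices /= hc hi eqxx.
by exists (exist (fun v => v \in nand_vertices) _ hv).
Qed.

Definition arc (v w : nand_vertex) : bool :=
  (kind v == 0) &&
  (if kind w == 0 then pos v \in P (pos w) else pos v <= pos w).

(** An arc has distinct endpoints: a loop could only sit at some A_v, and would make a gate its own
    in-neighbour, against [P_lt]. *)
Lemma nand_edgeE v w : nand_edge v w <-> arc v w || arc w v.
Proof.
rewrite /nand_edge /adj !svalE /=; split=> [[]//|h]; split=> // e.
have {e} vw : v = w by move: e => [? ? _]; apply: nand_vertex_inj.
move: h; rewrite vw orbb /arc; case: (kind w == 0) => //=.
by move/(P_lt (pos_lt w)); rewrite ltnn.
Qed.

(** Suppose w has the neighbours of A_v. As A_v sees B_v, so does w; twins see no twins, so w is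
    some A_u with u <= v. Testing both on B_u gives v <= u, hence w = A_v. *)
Lemma sat_fTwin a x :
  1 < x -> fo_sat nand_edge a (fTwin x) <-> kind (a x) != 0.
Proof.
move=> x1; have [x_0 x_1] : x != 0 /\ x != 1 by lia.
rewrite /= /update /= (negPf x_0) (negPf x_1).
move: (a x) => v {a x x1 x_0 x_1}; split=> [[w [vw twin]]|kv].
  apply/negP => /eqP kv.
  have {}twin z : arc v z || arc z v = (arc w z || arc z w).
    have := twin z; rewrite !nand_edgeE.
    by case: (arc v z || _); case: (arc w z || _) => // -[] [] //; intuition.
  have [b [kb ib]] := nand_vertex_ex (isT : 1 < 3) (pos_lt v).
  have := twin b; rewrite /arc kb ib kv leqnn /= ?orbF.
  case kw: (kind w == 0) => //= /esym wv; rewrite ?orbF in wv.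
  have [b' [kb' ib']] := nand_vertex_ex (isT : 1 < 3) (pos_lt w).
  have := twin b'; rewrite /arc kb' ib' kv kw leqnn /= ?orbF => vw'.
  apply: vw; apply: nand_vertex_inj; first by rewrite kv (eqP kw).
  by apply/eqP; rewrite eqn_leq vw' wv.
have kv3 := kind_lt v.
(* The map 3 - c exchanges the kinds 1 and 2, so w is the other twin over the same position. *)
have [|w [kw iw]] := @nand_vertex_ex (3 - kind v) (pos v) _ (pos_lt v); first lia.
exists w; split=> [vw|z]; first by move: kw; rewrite -vw; lia.
rewrite !nand_edgeE /arc iw kw (negPf kv) /=.
have -> : (3 - kind v == 0) = false by lia.
by case: (_ && _) => /=; [left | right].
Qed.

Lemma sat_fLess a x y :
  2 < x -> 2 < y -> kind (a x) = 0 -> kind (a y) = 0 ->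
  fo_sat nand_edge a (fLess x y) <-> pos (a x) < pos (a y).
Proof.
move=> x2 y2 kx ky; rewrite [fo_sat _ _ _]/=.
set T := fTwin 2; have hT b : fo_sat nand_edge b T <-> kind (b 2) != 0 by apply: sat_fTwin.
have [hx hy] : x != 2 /\ y != 2 by lia.
rewrite /update (negPf hx) (negPf hy) /=.
split=> [[v [/hT kv []]]|xy].
  move: kv; rewrite /= !nand_edgeE /arc kx ky /= => /negPf -> /=; rewrite !orbF => h.
  by move/negP; rewrite -ltnNge; apply: leq_ltn_trans.
(* The twin over x itself separates: A_y sees it only if y <= x. *)
have [b [kb ib]] := nand_vertex_ex (isT : 1 < 3) (pos_lt (a x)).
exists b; split; first by apply/hT; rewrite /= kb.
rewrite !nand_edgeE /arc kx ky kb ib /= !orbF leqnn; split=> //.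
by apply/negP; rewrite -ltnNge.
Qed.

Lemma sat_fPred a z y :
  2 < z -> 2 < y -> kind (a y) = 0 ->
  fo_sat nand_edge a (fPred z y) <->
  kind (a z) = 0 /\ pos (a z) \in P (pos (a y)).
Proof.
move=> z2 y2 ky.
have hT : fo_sat nand_edge a (FNot (fTwin z)) <-> kind (a z) = 0.
  rewrite /fo_sat -/fo_sat sat_fTwin; last by lia.
  by split=> [/negP|->//]; rewrite negbK => /eqP.
have -> : fo_sat nand_edge a (fPred z y) <->
   fo_sat nand_edge a (FNot (fTwin z)) /\ nand_edge (a z) (a y) /\ fo_sat nand_edge a (fLess z y) by [].
rewrite hT; split=> [[kz]|[kz hz]]; rewrite sat_fLess // nand_edgeE /arc kz ky /=.
  case=> /orP[h _//|h lt]; have := P_lt (pos_lt _) h; lia.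
by rewrite hz; do 2!split=> //; apply: P_lt hz; apply: pos_lt.
Qed.

Lemma sat_fSource a y :
  3 < y -> kind (a y) = 0 ->
  fo_sat nand_edge a (fSource y) <-> P (pos (a y)) = [::].
Proof.
move=> y3 ky.
have E v : update a 3 v y = a y by rewrite update_neq //; lia.
have hv v : fo_sat nand_edge (update a 3 v) (fPred 3 y) <->
    kind v = 0 /\ pos v \in P (pos (a y)).
  by rewrite sat_fPred ?E ?update_eq //; lia.
have -> : fo_sat nand_edge a (fSource y) <->
  forall v, ~ fo_sat nand_edge (update a 3 v) (fPred 3 y) by [].
split=> [h|e v /hv[_]]; last by rewrite e.
case e: (P _) => [//|j s].
have hj : j \in P (pos (a y)) by rewrite e mem_head.
have [v [kv iv]] := nand_vertex_ex (isT : 0 < 3) (ltn_trans (P_lt (pos_lt _) hj) (pos_lt _)).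
by case: (h v); apply/hv; rewrite kv iv.
Qed.

Lemma sat_fLast a y :
  3 < y -> fo_sat nand_edge a (fLast y) <-> kind (a y) = 0 /\ pos (a y) = m.-1.
Proof.
move=> y3.
have E v : update a 3 v y = a y by rewrite update_neq //; lia.
have -> : fo_sat nand_edge a (fLast y) <->
   ~ fo_sat nand_edge a (fTwin y) /\ forall v, fo_sat nand_edge (update a 3 v) (fTwin 3) \/
     ~ fo_sat nand_edge (update a 3 v) (fLess y 3) by [].
rewrite sat_fTwin; last by lia.
have y_lt := pos_lt (a y).
split=> [[/negP]|[ky iy]].
  rewrite negbK => /eqP ky h; split=> //.
  have [|v [kv iv]] := @nand_vertex_ex 0 m.-1 isT _; first lia.
  have := h v; rewrite sat_fTwin // sat_fLess ?E ?update_eq ?kv //; last by lia.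
  by case=> // /negP; rewrite iv; lia.
split=> [|v]; first by rewrite ky.
rewrite sat_fTwin // update_eq; case kv: (kind v) => [|c]; last by left.
right; rewrite sat_fLess ?E ?update_eq //; last by lia.
by have := pos_lt v; lia.
Qed.

(** NAND evaluation with S as the set of true sources, cut off after l levels. A gate reached with
    too few levels left may get a wrong value, so l must exceed the depth below it. *)
Fixpoint nand_val (S : pred nat) (l i : nat) : bool :=
  S i || (if l is l'.+1 then has (fun j => ~~ nand_val S l' j) (P i) else false).

Definition selected (X : seq nat) (a : nat -> nand_vertex) : pred nat :=
  fun i => has (fun x => (kind (a x) == 0) && (pos (a x) == i)) X.

Lemma sat_fIn a X y :
  kind (a y) = 0 -> fo_sat nand_edge a (fIn X y) <-> selected X a (pos (a y)).
Proof.
move=> ky; rewrite fo_sat_fIn; split=> [[x xX e]|/hasP[x xX /andP[/eqP kx /eqP ix]]].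
  by apply/hasP; exists x; rewrite // -e ky !eqxx.
by exists x => //; apply: nand_vertex_inj; rewrite ?kx ?ix.
Qed.

Lemma selected_update X a x v :
  x \notin X -> selected X (update a x v) =1 selected X a.
Proof.
move=> xX i; apply: eq_in_has => y yX; rewrite update_neq //.
by apply: contraNneq xX => <-.
Qed.

Lemma nand_val_ext S S' l i : S =1 S' -> nand_val S l i = nand_val S' l i.
Proof.
move=> e; elim: l i => [|l IH] i /=; rewrite e //.
by congr orb; apply: eq_has => j; rewrite IH.
Qed.

(** The bound on X puts the chosen inputs above all variables that [fVal] rebinds, so the selected
    set stays the same under its quantifiers. *)
Lemma sat_fVal X l a :
  all (fun x => l.+4 < x) X -> kind (a l.+4) = 0 ->
  fo_sat nand_edge a (fVal X l) <-> nand_val (selected X a) l (pos (a l.+4)).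
Proof.
elim: l a => [|l IH] a hX ka; first by rewrite [fVal _ _]/= sat_fIn // [nand_val _ _ _]/= orbF.
have -> : fo_sat nand_edge a (fVal X l.+1) <-> fo_sat nand_edge a (fIn X l.+1.+4) \/
  exists v, fo_sat nand_edge (update a l.+4 v) (fPred l.+4 l.+1.+4) /\
     ~ fo_sat nand_edge (update a l.+4 v) (fVal X l) by [].
have E v : update a l.+4 v l.+1.+4 = a l.+1.+4 by rewrite update_neq //; lia.
have hX' : all (fun x => l.+4 < x) X by apply: sub_all hX => x /ltnW.
have lX : l.+4 \notin X.
  by apply/negP => /(allP hX); lia.
have h1 v : fo_sat nand_edge (update a l.+4 v) (fPred l.+4 l.+1.+4) <->
    kind v = 0 /\ pos v \in P (pos (a l.+1.+4)).
  by rewrite sat_fPred ?E ?update_eq.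
have h2 v : kind v = 0 -> fo_sat nand_edge (update a l.+4 v) (fVal X l) <->
    nand_val (selected X a) l (pos v).
  move=> kv; rewrite IH ?update_eq //.
  by rewrite (nand_val_ext _ _ (selected_update _ _ lX)).
rewrite sat_fIn // [nand_val _ _ _]/=; split=> [[->//|[v [/h1[kv hv] /(h2 v kv)/negP hn]]]|/orP[h|/hasP[j hj hn]]].
- by apply/orP; right; apply/hasP; exists (pos v).
- by left.
right; have [v [kv iv]] := nand_vertex_ex (isT : 0 < 3) (ltn_trans (P_lt (pos_lt _) hj) (pos_lt _)).
exists v; split; first by apply/h1; rewrite kv iv.
by rewrite h2 // iv; apply/negP.
Qed.

Lemma sat_fDistinct X a x :
  3 < x -> fo_sat nand_edge a (fDistinct X x) <->
  [/\ forall y, y \in X -> x != y -> a x <> a y, kind (a x) = 0 & P (pos (a x)) = [::]].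
Proof.
move=> x3; rewrite fo_sat_foldr_FAnd.
have -> : fo_sat nand_edge a (FAnd (FNot (fTwin x)) (fSource x)) <->
  kind (a x) = 0 /\ P (pos (a x)) = [::].
  have -> : fo_sat nand_edge a (FAnd (FNot (fTwin x)) (fSource x)) <->
    ~ fo_sat nand_edge a (fTwin x) /\ fo_sat nand_edge a (fSource x) by [].
  rewrite sat_fTwin; last by lia.
  split=> [[/negP]|[kx]]; first by rewrite negbK => /eqP kx; rewrite sat_fSource.
  by rewrite sat_fSource // kx.
split=> [[h []]|[h kx px]].
  by split=> // y yX xy; have := h y yX; rewrite (negPf xy).
split=> // y yX; case: eqP => [_ //|/eqP xy]; exact: h.
Qed.

Lemma models_fSat L k : 0 < m ->
  models nand_edge (fSat L k) <->
  exists s : seq nat, [/\ size s = k, uniq s,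
    forall i, i \in s -> i < m /\ P i = [::] & nand_val (mem s) L m.-1].
Proof.
move=> m_gt0.
have [v0 _] := nand_vertex_ex (isT : 0 < 3) m_gt0.
pose X := [seq L.+1.+4 + i | i <- iota 0 k].
have X_uniq : uniq X by rewrite map_inj_uniq ?iota_uniq // => i j /addnI.
have X_size : size X = k by rewrite size_map size_iota.
have X_lt : all (fun x => L.+4 < x) X by apply/allP => _ /mapP[i _ ->]; lia.
have LX : L.+4 \notin X by apply/negP => /(allP X_lt); rewrite ltnn.
have key e : fo_sat nand_edge e (fBody X L) <->
  [/\ {in X &, injective e}, forall x, x \in X -> kind (e x) = 0 /\ P (pos (e x)) = [::]
    & nand_val (selected X e) L m.-1].
  rewrite fo_sat_foldr_FAnd.
  have -> : fo_sat nand_edge e (FEx L.+4 (FAnd (fLast L.+4) (fVal X L))) <->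
      nand_val (selected X e) L m.-1.
    have -> : fo_sat nand_edge e (FEx L.+4 (FAnd (fLast L.+4) (fVal X L))) <->
      exists v, fo_sat nand_edge (update e L.+4 v) (fLast L.+4) /\
        fo_sat nand_edge (update e L.+4 v) (fVal X L) by [].
    have hl v : fo_sat nand_edge (update e L.+4 v) (fLast L.+4) <-> kind v = 0 /\ pos v = m.-1.
      by rewrite sat_fLast ?update_eq.
    have hv v : kind v = 0 -> fo_sat nand_edge (update e L.+4 v) (fVal X L) <->
        nand_val (selected X e) L (pos v).
      move=> kv; rewrite sat_fVal ?update_eq //.
      by rewrite (nand_val_ext _ _ (selected_update _ _ LX)).
    split=> [[v [/hl[kv iv] /(hv v kv)]]|h]; first by rewrite iv.
    have [|v [kv iv]] := @nand_vertex_ex 0 m.-1 isT _; first lia.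
    by exists v; split; [apply/hl | apply/hv; rewrite ?iv].
  split=> [[h ->]|[e_inj hs ->]]; split=> //.
  - move=> x y xX yX exy; apply/eqP; apply: contraT => xy.
    have /sat_fDistinct := h x xX; case; first by have := allP X_lt x xX; lia.
    by move=> /(_ y yX xy).
  - move=> x xX; have /sat_fDistinct := h x xX; case=> //.
    by have := allP X_lt x xX; lia.
  move=> x xX; apply/sat_fDistinct; first by have := allP X_lt x xX; lia.
  have [kx px] := hs x xX; split=> // y yX /eqP xy exy.
  by apply: xy; apply: e_inj.
split=> [/(_ (fun=> v0))/fo_sat_foldr_FEx[e _ /key[e_inj hs hv]]|[s [sk s_uniq hs hv]] a].
  exists [seq pos (e x) | x <- X]; split.
  - by rewrite size_map.
  - rewrite map_inj_in_uniq // => x y xX yX exy; apply: e_inj => //.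
    by apply: nand_vertex_inj => //; rewrite !(proj1 (hs _ _)).
  - by move=> _ /mapP[x xX ->]; split; [apply: pos_lt | case: (hs x xX)].
  rewrite -(nand_val_ext _ _ (_ : selected X e =1 _)) // => i.
  apply/hasP/mapP => [[x xX /andP[_ /eqP <-]]|[x xX ->]]; exists x => //.
  by rewrite (proj1 (hs x xX)) !eqxx.
have hw i : exists v, i \in s -> kind v = 0 /\ pos v = i.
  case si: (i \in s); last by exists v0.
  by have [v h] := nand_vertex_ex (isT : 0 < 3) (proj1 (hs i si)); exists v.
(* The vertices A_i for i in s are chosen one by one, by induction on their number, so no choice
   axiom is involved. *)
have [w hw'] : exists w : nat -> nand_vertex, forall i, i < k -> kind (w i) = 0 /\ pos (w i) = nth 0 s i.
  have : forall k', k' <= k -> exists w : nat -> nand_vertex, forall i, i < k' -> kind (w i) = 0 /\ pos (w i) = nth 0 s i.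
    elim=> [|k' IH] hk'; first by exists (fun=> v0).
    have [w hw'] := IH (ltnW hk'); have [v hv'] := hw (nth 0 s k').
    exists (fun i => if i == k' then v else w i) => i; rewrite ltnS leq_eqVlt.
    case: eqP => [-> _|_ /= /hw' //]; apply: hv'; apply: mem_nth; rewrite sk; exact: hk'.
  by move/(_ k (leqnn k)).
apply/fo_sat_foldr_FEx.
(* Subtracting L + 5 turns a variable of X into its index in s. *)
pose e y := if y \in X then w (y - L.+1.+4) else a y.
exists e; first by move=> y /negPf yX; rewrite /e yX.
have eX i : i < k -> e (L.+1.+4 + i) = w i.
  move=> ik; rewrite /e addKn ifT //; apply/mapP; exists i => //.
  by rewrite mem_iota.
apply/key; split.
- move=> _ _ /mapP[i hi ->] /mapP[j hj ->]; rewrite !mem_iota /= in hi hj.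
  rewrite !eX // => wij; congr (_ + _); apply/eqP.
  rewrite -(nth_uniq 0 _ _ s_uniq) ?sk //; apply/eqP.
  by rewrite -(proj2 (hw' i hi)) -(proj2 (hw' j hj)) wij.
- move=> _ /mapP[i hi ->]; rewrite mem_iota /= in hi; rewrite eX //.
  have [kw iw] := hw' i hi; rewrite kw iw; split=> //.
  by apply: (proj2 (hs _ _)); rewrite mem_nth ?sk.
rewrite (nand_val_ext _ _ (_ : _ =1 mem s)) // => i.
apply/hasP/idP => [[_ /mapP[j hj ->] /andP[_ /eqP <-]]|si].
  rewrite mem_iota /= in hj; rewrite eX // (proj2 (hw' j hj)).
  by apply: mem_nth; rewrite sk.
have ik : index i s < k by rewrite -sk index_mem.
exists (L.+1.+4 + index i s); first by apply/mapP; exists (index i s); rewrite ?mem_iota.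
by have [kw iw] := hw' _ ik; rewrite eX // kw iw nth_index ?eqxx.
Qed.

End NandGraph.

(** * Free variables, and graphs in powers of the hypercube *)

(** A top-down check with an environment X of bound variables, which is easier to follow through the
    folds than the filtered lists of [free_vars]. *)
Fixpoint fv_in (X : seq nat) (phi : fo) : bool :=
  match phi with
  | FAdj x y | FEq x y => (x \in X) && (y \in X)
  | FNot f => fv_in X f
  | FAnd f g | FOr f g => fv_in X f && fv_in X g
  | FEx x f | FAll x f => fv_in (x :: X) f
  end.

Lemma fv_in_subset X phi : fv_in X phi -> {subset free_vars phi <= X}.
Proof.
elim: phi X => [x y|x y|f IH|f IHf g IHg|f IHf g IHg|x f IH|x f IH] X /=.
- by case/andP=> xX yX z; rewrite !inE => /orP[] /eqP ->.
- by case/andP=> xX yX z; rewrite !inE => /orP[] /eqP ->.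
- exact: IH.
- by case/andP=> /IHf hf /IHg hg z; rewrite mem_cat => /orP[/hf|/hg].
- by case/andP=> /IHf hf /IHg hg z; rewrite mem_cat => /orP[/hf|/hg].
- by move/IH=> h z; rewrite mem_filter => /andP[/negPf zx /h]; rewrite inE zx.
by move/IH=> h z; rewrite mem_filter => /andP[/negPf zx /h]; rewrite inE zx.
Qed.

Lemma fv_in_sentence phi : fv_in [::] phi -> sentence phi.
Proof.
move/fv_in_subset; rewrite /sentence; case: free_vars => // x s /(_ x).
by rewrite mem_head => /(_ isT).
Qed.

Lemma fv_fTwin X x : x \in X -> fv_in X (fTwin x).
Proof. by move=> xX; rewrite /= !inE !xX !eqxx !orbT. Qed.

Lemma fv_fLess X x y : x \in X -> y \in X -> fv_in X (fLess x y).
Proof. by move=> xX yX; rewrite /= !inE !xX !yX !eqxx !orbT. Qed.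

Lemma fv_fPred X x y : x \in X -> y \in X -> fv_in X (fPred x y).
Proof.
move=> xX yX; rewrite /fPred /fv_in -/fv_in; apply/and3P; split.
- exact: fv_fTwin.
- by rewrite xX yX.
exact: fv_fLess.
Qed.

Lemma fv_fIn X Y y : {subset X <= Y} -> y \in Y -> fv_in Y (fIn X y).
Proof.
move=> + yY; elim: X => [|x X IH] sXY /=; first by rewrite yY.
rewrite yY sXY ?mem_head // IH // => z zX.
by apply: sXY; rewrite inE zX orbT.
Qed.

Lemma fv_fVal X Y l : {subset X <= Y} -> l.+4 \in Y -> fv_in Y (fVal X l).
Proof.
elim: l Y => [|l IH] Y sXY lY; first exact: fv_fIn.
rewrite /fVal -/fVal /fv_in -/fv_in fv_fIn // fv_fPred ?mem_head ?inE ?lY ?orbT //=.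
apply: IH; last exact: mem_head.
by move=> x /sXY; rewrite inE => ->; rewrite orbT.
Qed.

Lemma fv_foldr_FAnd (X Y : seq nat) (F : nat -> fo) f :
  (forall x, x \in X -> fv_in Y (F x)) -> fv_in Y f ->
  fv_in Y (foldr (fun x g => FAnd (F x) g) f X).
Proof.
elim: X => //= x X IH h hf; rewrite h ?mem_head // IH // => y yX.
by apply: h; rewrite inE yX orbT.
Qed.

Lemma fv_foldr_FEx X Y f : fv_in (catrev X Y) f -> fv_in Y (foldr FEx f X).
Proof. by elim: X Y => //= x X IH Y /IH. Qed.

Lemma sentence_fSat L k : sentence (fSat L k).
Proof.
apply: fv_in_sentence; apply: fv_foldr_FEx; set X := map _ _.
have hX x : x \in X -> x \in catrev X [::] by rewrite -[catrev X _]/(rev X) mem_rev.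
apply: fv_foldr_FAnd => [x xX|].
  apply: fv_foldr_FAnd => [y yX|].
    by case: ifP => _ /=; rewrite !hX.
  rewrite /fv_in -/fv_in; apply/andP; split; first exact/fv_fTwin/hX.
  suff : fv_in (3 :: catrev X [::]) (fPred 3 x) by [].
  by apply: fv_fPred; rewrite inE ?eqxx // hX ?orbT.
rewrite /fv_in -/fv_in; apply/andP; split; last first.
  by apply: fv_fVal; rewrite ?mem_head // => x /hX; rewrite inE orbC => ->.
rewrite /fLast /fv_in -/fv_in; apply/and3P; split.
- by apply: fv_fTwin; rewrite mem_head.
- by apply: fv_fTwin; rewrite mem_head.
by apply: fv_fLess; rewrite !inE eqxx ?orbT.
Qed.

(** * Distances in the hypercube *)

Definition hamming (d : nat) (u v : d.-tuple bool) : nat :=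
  #|[set i | tnth u i != tnth v i]|.

Lemma hamming_triangle d (u v w : d.-tuple bool) :
  hamming u w <= hamming u v + hamming v w.
Proof.
apply: leq_trans (leq_card_setU _ _); apply: subset_leq_card.
by apply/subsetP => i; rewrite !inE; case: (tnth u i) (tnth v i) (tnth w i) => [] [] [].
Qed.

Lemma hamming_eq0 d (u v : d.-tuple bool) : hamming u v = 0 -> u = v.
Proof.
move/cards0_eq => e; apply: eq_from_tnth => i; apply/eqP.
by have /setP/(_ i) := e; rewrite !inE => /negbFE.
Qed.

Lemma hypercube_path d n (u v : d.-tuple bool) :
  hamming u v = n -> exists p, [/\ path (@hypercube d) u p, last u p = v & size p = n].
Proof.
elim: n u => [|n IH] u huv; first by exists [::]; rewrite (hamming_eq0 huv).
have [i hi] : exists i, i \in [set i | tnth u i != tnth v i].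
  by apply/card_gt0P; rewrite -/(hamming u v) huv.
pose u' := [tuple if j == i then tnth v j else tnth u j | j < d].
have u'E j : tnth u' j = if j == i then tnth v j else tnth u j by rewrite tnth_mktuple.
have D : [set j | tnth u' j != tnth v j] = [set j | tnth u j != tnth v j] :\ i.
  by apply/setP => j; rewrite !inE u'E; case: (j =P i) => [->|_]; rewrite ?eqxx.
have [|p [pp pl ps]] := IH u'.
  have := cardsD1 i [set j | tnth u j != tnth v j].
  by rewrite hi -D -/(hamming u v) huv => -[].
exists (u' :: p); rewrite /= pp pl ps; split=> //; rewrite andbT /hypercube.
have -> : [set j | tnth u j != tnth u' j] = [set i]; last by rewrite cards1.
apply/setP => j; rewrite !inE u'E; case: (j =P i) => [->|_]; last by rewrite eqxx.
by rewrite inE in hi.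
Qed.

(** Path distance in the cube is Hamming distance: each edge contributes one in the triangle
    inequality, and correcting the differing coordinates one at a time yields a walk of that
    length. *)
Lemma power_hypercube d r (u v : d.-tuple bool) :
  power (@hypercube d) r u v <-> u <> v /\ hamming u v <= r.
Proof.
split=> [[uv [p [pp pv pr]]]|[uv h]]; split=> //.
  rewrite -pv; apply: (leq_trans _ pr); elim: p u {uv pv pr} pp => [|w p IH] u /=.
    move=> _; by rewrite /hamming eq_card0 // => i; rewrite !inE eqxx.
  case/andP=> /eqP uw /IH h; apply: leq_trans (hamming_triangle u w _) _.
  by rewrite /hamming uw add1n ltnS.
have [p [pp pl ps]] := hypercube_path (erefl (hamming u v)).
by exists p; rewrite ps.
Qed.

(** On lists the distance is additive over concatenation, which fits vectors built from blocks of
    two bits. *)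
Definition seq_dist (s t : seq bool) : nat := count (fun p => p.1 != p.2) (zip s t).

Lemma hammingE d (u v : d.-tuple bool) : hamming u v = seq_dist u v.
Proof.
rewrite /hamming /seq_dist cardE size_filter.
have -> : zip u v = [seq (tnth u i, tnth v i) | i <- enum 'I_d].
  apply: (@eq_from_nth _ (false, false)).
    by rewrite size_zip !size_tuple minnn ?card_ord.
  move=> i; rewrite size_zip !size_tuple minnn => hi.
  rewrite nth_zip ?size_tuple // (nth_map (Ordinal hi)) ?size_enum_ord //.
  by rewrite (nth_ord_enum _ (Ordinal hi)) !(tnth_nth false).
by rewrite [RHS]count_map enumT; apply: eq_count => i; rewrite /= inE.
Qed.

(** * Arbitrary graphs as induced subgraphs of cube powers *)

Section Embedding.

Variables (T : choiceType) (e : rel T) (V : seq T).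
Local Notation vec := (vec e V).

Lemma size_vec v : size (vec v) == dimension V.
Proof.
rewrite /vec size_flatten /shape -map_comp; apply/eqP.
have -> : sumn (map (size \o bits e v) (coords V)) = 2 * size (coords V).
  by elim: (coords V) => // c s; rewrite /= => ->; lia.
rewrite /dimension /coords; congr (2 * _).
rewrite size_flatten /shape -map_comp.
have E s : sumn (map (size \o (fun a => [seq (a, b) | b <- V])) s) = size s * size V.
  by elim: s => //= a s ->; rewrite size_map mulSn.
exact: E.
Qed.

Definition cube (v : T) : (dimension V).-tuple bool := Tuple (size_vec v).

Definition cubes : seq ((dimension V).-tuple bool) := map cube V.

Hypothesis V_uniq : uniq V.
Hypothesis e_irr : forall a, a \in V -> ~~ e a a.

Lemma seq_dist_flatten (I : Type) (f g : I -> seq bool) (s : seq I) :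
  (forall c, size (f c) = size (g c)) ->
  seq_dist (flatten (map f s)) (flatten (map g s)) = \sum_(c <- s) seq_dist (f c) (g c).
Proof.
move=> fg; elim: s => [|c s IH]; first by rewrite big_nil.
by rewrite big_cons -IH /seq_dist /= zip_cat // count_cat.
Qed.

Lemma sum_delta (v : T) (F : T -> nat) :
  v \in V -> \sum_(a <- V) (v == a) * F a = F v.
Proof.
move=> vV; rewrite (bigD1_seq v) //= eqxx mul1n big1 ?addn0 // => a.
by rewrite eq_sym => /negPf ->.
Qed.

Lemma seq_dist_vec v w : v \in V -> w \in V -> v != w ->
  seq_dist (vec v) (vec w) + 2 * (e v w + e w v) = 4 * size V.
Proof.
move=> vV wV vw.
(* The contribution of one block. The correction stands on the left, which avoids truncated
   subtraction. *)
have key a b : a \in V -> seq_dist (bits e v (a, b)) (bits e w (a, b)) +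
    2 * ((v == a) * ((w == b) * e a b) + (w == a) * ((v == b) * e a b)) =
    ((v == a) * 1 + (w == a) * 1) + ((v == b) * 1 + (w == b) * 1).
  move=> aV; rewrite /seq_dist /bits /=.
  (* The facts h1 to h4 exclude v = w and loops of e; what remains is a finite check over five
     Booleans. *)
  have h1 : ~~ ((v == a) && (w == a)) by apply/negP => /andP[/eqP <- /eqP ewv]; rewrite ewv eqxx in vw.
  have h2 : ~~ ((v == b) && (w == b)) by apply/negP => /andP[/eqP <- /eqP ewv]; rewrite ewv eqxx in vw.
  have h3 : ~~ [&& v == a, v == b & e a b].
    by apply/negP => /and3P[/eqP va /eqP vb]; apply/negP; rewrite -vb va e_irr.
  have h4 : ~~ [&& w == a, w == b & e a b].
    by apply/negP => /and3P[/eqP va /eqP vb]; apply/negP; rewrite -vb va e_irr.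
  by move: h1 h2 h3 h4; case: (v == a); case: (w == a); case: (v == b); case: (w == b); case: (e a b).
rewrite /vec seq_dist_flatten // big_flatten /= big_map.
have -> : 2 * (e v w + e w v) = \sum_(a <- V) \sum_(b <- V)
    2 * ((v == a) * ((w == b) * e a b) + (w == a) * ((v == b) * e a b)).
  under eq_bigr => a _ do rewrite -big_distrr big_split -!big_distrr !sum_delta //.
  by rewrite -big_distrr big_split !sum_delta.
under eq_bigr => a _ do rewrite big_map.
rewrite -big_split; under eq_big_seq => a aV do rewrite -big_split.
transitivity (\sum_(a <- V) \sum_(b <- V)
  (((v == a) * 1 + (w == a) * 1) + ((v == b) * 1 + (w == b) * 1))).
  by apply: eq_big_seq => a aV; apply: eq_bigr => b _; apply: key.
transitivity (\sum_(a <- V) (((v == a) * 1 + (w == a) * 1) * size V + 2)).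
  have E : \sum_(b <- V) ((v == b) * 1 + (w == b) * 1) = 2.
    by rewrite big_split !sum_delta.
  by apply: eq_bigr => a _; rewrite big_split /= E big_const_seq count_predT iter_addn_0.
rewrite big_split -big_distrl big_split !sum_delta //= big_const_seq count_predT iter_addn_0; lia.
Qed.

(** Distinct v and w have distance at least 4 N - 4, where N = [size V], and N > 1 because both
    occur in V. *)
Lemma cube_inj v w : v \in V -> w \in V -> cube v = cube w -> v = w.
Proof.
move=> vV wV evw; apply/eqP; apply: contraT => vw.
have V_gt1 : 1 < size V.
  have : size [:: v; w] <= size V.
    by apply: uniq_leq_size; rewrite /= ?inE ?vw // => x; rewrite !inE => /orP[] /eqP ->.
  by [].
have := seq_dist_vec vV wV vw; have /= -> := congr1 val evw.
have -> : seq_dist (vec w) (vec w) = 0.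
  by rewrite /seq_dist; elim: (vec w) => //= b s ->; rewrite eqxx.
by case: (e v w) (e w v) => [] []; lia.
Qed.

(** Without an arc the distance is 4 N, where N = [size V]; one arc or two bring it down to 4 N - 2
    or 4 N - 4. The radius 4 N - 2 separates these cases. *)
Lemma power_cube v w : v \in V -> w \in V ->
  power (@hypercube (dimension V)) (radius V) (cube v) (cube w) <->
  v <> w /\ e v w || e w v.
Proof.
move=> vV wV; rewrite power_hypercube hammingE /=.
have V_gt0 : 0 < size V by case: (V) vV.
case: (v =P w) => [->|/eqP vw]; first by split=> [[]|[]].
have := seq_dist_vec vV wV vw; rewrite /radius; set S := seq_dist _ _ => D.
split=> [[_ h]|[_ h]]; split.
- exact/eqP.
- by move: D h; case: (e v w); case: (e w v) => //=; lia.
- by move/(cube_inj vV wV)/eqP; rewrite (negPf vw).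
by move: D h; case: (e v w); case: (e w v) => //=; lia.
Qed.

Definition symmetrized (u v : {v : T | v \in V}) : Prop :=
  sval u <> sval v /\ e (sval u) (sval v) || e (sval v) (sval u).

Lemma models_cubes phi :
  models (@induced _ (power (@hypercube (dimension V)) (radius V)) cubes) phi <->
  models symmetrized phi.
Proof.
pose h (v : {v : T | v \in V}) : {w | w \in cubes} :=
  exist (fun w => w \in cubes) (cube (sval v)) (map_f cube (svalP v)).
have h_inj : injective h.
  move=> v w evw; apply: val_inj; apply: (cube_inj (svalP v) (svalP w)).
  exact: (congr1 (fun z => sval z) evw).
have h_sur w : exists v, h v = w.
  have /mapP[v vV wE] := svalP w.
  by exists (exist (fun v => v \in V) v vV); apply: val_inj; rewrite /= wE.
have hE u v : symmetrized u v <->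
    induced (power (@hypercube (dimension V)) (radius V)) (h u) (h v).
  exact: iff_sym (power_cube (svalP u) (svalP v)).
split=> hphi a; last first.
  (* In Boolean form, so that [xchoose] can pick preimages and pull an assignment back along h. *)
  have h_sur' w : exists v, h v == w by have [v <-] := h_sur w; exists v.
  pose b x := xchoose (h_sur' (a x)).
  apply: (proj1 (fo_sat_ext _ _ (_ : h \o b =1 a))).
    by move=> x; apply/eqP; apply: (xchooseP (h_sur' (a x))).
  by apply/(fo_sat_iso _ _ h_inj h_sur hE).
by apply/(fo_sat_iso _ _ h_inj h_sur hE).
Qed.

End Embedding.

(** * Circuits and NAND networks *)

Definition topological (C : circuit) : Prop :=
  forall j i, j < size C -> i \in preds (node C j) -> i < j.

Lemma circuit_wf_gate C j : circuit_wf C -> j < size C -> gate_wf j (node C j).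
Proof. by move/allP=> h hj; apply: h; rewrite mem_iota. Qed.

Lemma circuit_wf_topological C : circuit_wf C -> topological C.
Proof. by move=> wf j i hj; case/and3P: (circuit_wf_gate wf hj) => _ /allP h _ /h. Qed.

(** Well-formedness gives every AND and OR gate at least two in-neighbours, so only inputs have
    none. *)
Lemma preds_nil C j :
  circuit_wf C -> j < size C -> (preds (node C j) == [::]) = is_input (node C j).
Proof.
move=> wf hj; case/and3P: (circuit_wf_gate wf hj) => _ _.
by case: (node C j) => // -[].
Qed.

Lemma io_path_rcons C z j i p : j < size C ->
  z \in preds (node C j) -> io_path C z i p -> io_path C j i (rcons p j).
Proof.
by move=> hj hz [hi ii hp hl]; split; rewrite ?last_rcons // rcons_path hp hl /edge hz.
Qed.

Lemma io_path_last C j i p : io_path C j i p ->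
  (p = [::] /\ i = j) \/
  exists z q, [/\ p = rcons q j, z \in preds (node C j) & io_path C z i q].
Proof.
case: (lastP p) => [|q x] [hi ii hp hl]; first by left.
right; exists (last i q), q; rewrite last_rcons in hl; rewrite -hl.
by move: hp; rewrite rcons_path => /andP[hp he]; split.
Qed.

(** Going back along in-neighbours ends at an input. Hence a bound on all paths to j is never
    vacuous, and really restricts j. *)
Lemma io_path_ex C j :
  circuit_wf C -> j < size C -> exists i p, io_path C j i p.
Proof.
move=> wf; elim/ltn_ind: j => j IH hj.
case e: (preds (node C j)) => [|z s].
  by exists j, [::]; split=> //; rewrite -preds_nil ?e.
have hz : z \in preds (node C j) by rewrite e mem_head.
have zj := circuit_wf_topological wf hj hz.
have [i [p hp]] := IH z zj (ltn_trans zj hj).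
by exists i, (rcons p j); apply: io_path_rcons hp.
Qed.

Lemma count_cons_rcons (T : Type) (a : pred T) x s y :
  count a (x :: rcons s y) = count a (x :: s) + a y.
Proof. by rewrite -rcons_cons -cats1 count_cat /= addn0. Qed.

(** A path to j is a path to an in-neighbour extended by j, so both bounds pass to the
    in-neighbours; w decreases exactly when j is large. *)
Lemma shallowP C l w j : circuit_wf C -> j < size C ->
  reflect (forall i p, io_path C j i p ->
             size p <= l /\ count (fun j => large (node C j)) (i :: p) <= w)
          (shallow l w C j).
Proof.
move=> wf; pose big j := large (node C j).
elim: l w j => [|l IH] w j hj.
  rewrite /shallow /=; apply: (iffP idP) => [h i p hp|h].
    have pn : preds (node C j) = [::].
      by move: h; case: ifP => _; [case/andP=> _|]; move/nilP.
    have [[-> ->]|[z [q [_ hz _]]]] := io_path_last hp; last by rewrite pn in hz.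
    by rewrite /= /large pn.
  (* Some path reaches j; having length 0, it shows that j is itself an input. *)
  have [i [p hp]] := io_path_ex wf hj.
  have [sz cn] := h _ _ hp.
  have [[ep ei]|[z [q [ep _ _]]]] := io_path_last hp; last by move: sz; rewrite ep size_rcons.
  case: hp => _ ii _ _; rewrite -ei.
  by move: ii; rewrite /large; case: (node C i).
have shallowE : shallow l.+1 w C j =
    (if big j then (0 < w) && all (shallow l w.-1 C) (preds (node C j))
     else all (shallow l w C) (preds (node C j))) by [].
rewrite shallowE; set w' := if big j then w.-1 else w.
have -> : (if big j then (0 < w) && all (shallow l w.-1 C) (preds (node C j))
     else all (shallow l w C) (preds (node C j))) =
    (big j <= w) && all (shallow l w' C) (preds (node C j)).
  by rewrite /w'; case: (big j).
have w'E : big j <= w -> w' + big j = w by rewrite /w'; case: (big j); lia.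
apply: (iffP andP) => [[bw /allP hall] i p hp|h].
  have [[-> ->]|[z [q [-> hz hq]]]] := io_path_last hp.
    by rewrite /= addn0.
  have zj := ltn_trans (circuit_wf_topological wf hj hz) hj.
  have [sq cq] := elimT (IH w' z zj) (hall z hz) _ _ hq.
  rewrite count_cons_rcons size_rcons; split=> //.
  by rewrite -(w'E bw) leq_add2r.
have bw : big j <= w.
  have [i [p hp]] := io_path_ex wf hj; have [_] := h _ _ hp.
  have [[-> ->]|[z [q [-> _ _]]]] := io_path_last hp; first by rewrite /= addn0.
  by rewrite count_cons_rcons; apply: leq_trans; rewrite leq_addl.
split=> //; apply/allP => z hz.
have zj := ltn_trans (circuit_wf_topological wf hj hz) hj.
apply/(IH w' z zj) => i q hq; have [] := h _ _ (io_path_rcons hj hz hq).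
rewrite count_cons_rcons size_rcons -{1}(w'E bw) leq_add2r.
by split.
Qed.

Lemma shallow_depth_weft C o h t : circuit_wf C -> o < size C ->
  shallow h t C o <-> weft_le C o t /\ depth_le C o h.
Proof.
move=> wf ho; split=> [/(shallowP _ _ wf ho) H|[hw hd]].
  by split=> i p /H[].
by apply/(shallowP _ _ wf ho) => i p hp; split; [apply: hd hp | apply: hw hp].
Qed.

Lemma circuit_vals_rcons a C g :
  circuit_vals a (rcons C g) =
  rcons (circuit_vals a C) (gate_val (a (size (circuit_vals a C))) (circuit_vals a C) g).
Proof. by rewrite /circuit_vals -cats1 foldl_cat. Qed.

Lemma size_circuit_vals a C : size (circuit_vals a C) = size C.
Proof.
by elim/last_ind: C => // C g IH; rewrite circuit_vals_rcons !size_rcons IH.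
Qed.

Lemma gate_val_eq inp v1 v2 g :
  (forall i, i \in preds g -> nth false v1 i = nth false v2 i) ->
  gate_val inp v1 g = gate_val inp v2 g.
Proof.
case: g => //= [i ->|s h|s h] //; first by rewrite inE.
  exact: eq_in_all.
exact: eq_in_has.
Qed.

(** A gate reads only earlier values, and appending later ones does not change these. So each value
    satisfies the equation of its gate with respect to the final list. *)
Lemma nth_circuit_vals a C j : topological C -> j < size C ->
  nth false (circuit_vals a C) j = gate_val (a j) (circuit_vals a C) (node C j).
Proof.
elim/last_ind: C j => // C g IH j top hj.
have topC : topological C.
  move=> k i hk hi; apply: top; first by rewrite size_rcons ltnW.
  by rewrite /node nth_rcons hk.
have stable v i : i < size C -> nth false (rcons (circuit_vals a C) v) i = nth false (circuit_vals a C) i.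
  by move=> hi; rewrite nth_rcons size_circuit_vals hi.
have hp i : i \in preds (node (rcons C g) j) -> i < size C.
  by move/(top _ _ hj) => ij; rewrite size_rcons ltnS in hj; apply: leq_trans ij hj.
rewrite circuit_vals_rcons (@gate_val_eq _ _ (circuit_vals a C)); last first.
  by move=> i /hp /stable.
move: hj; rewrite size_rcons ltnS leq_eqVlt => /predU1P[->|hj].
  by rewrite /node !nth_rcons size_circuit_vals ltnn eqxx.
by rewrite stable // /node nth_rcons hj IH.
Qed.

(** The in-neighbours of [nand_nodes], as a function of the position. The last gate is tested first,
    since 3 n is also divisible by 3. *)
Definition nand_preds (C : circuit) (o i : nat) : seq nat :=
  if i == 3 * size C then [:: (3 * o).+1]
  else if i %% 3 == 0 then first_preds (node C (i %/ 3))
  else if i %% 3 == 1 then second_preds (i %/ 3) (node C (i %/ 3))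
  else [:: i.-1].

Section NandPreds.

Variables (C : circuit) (o : nat).
Local Notation P := (nand_preds C o).
Let m := (3 * size C).+1.

Lemma nand_preds0 j : j < size C -> P (3 * j) = first_preds (node C j).
Proof.
move=> hj; rewrite /nand_preds ifF; last by lia.
rewrite ifT; last by lia.
by rewrite (_ : 3 * j %/ 3 = j); last lia.
Qed.

Lemma nand_preds1 j : j < size C -> P (3 * j).+1 = second_preds j (node C j).
Proof.
move=> hj; rewrite /nand_preds ifF; last by lia.
rewrite ifF; last by lia.
rewrite ifT; last by lia.
by rewrite (_ : (3 * j).+1 %/ 3 = j); last lia.
Qed.

Lemma nand_preds2 j : j < size C -> P (3 * j).+2 = [:: (3 * j).+1].
Proof. by move=> hj; rewrite /nand_preds !ifF //; lia. Qed.

Lemma nand_preds_last : P (3 * size C) = [:: (3 * o).+1].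
Proof. by rewrite /nand_preds eqxx. Qed.

Lemma nand_cases i : i < m ->
  i = 3 * size C \/ exists2 j, j < size C & [\/ i = 3 * j, i = (3 * j).+1 | i = (3 * j).+2].
Proof.
move=> hi; case: (i =P 3 * size C) => [->|hn]; first by left.
right; exists (i %/ 3); first by lia.
have : i %% 3 = 0 \/ i %% 3 = 1 \/ i %% 3 = 2 by lia.
case=> [?|[?|?]]; [constructor 1 | constructor 2 | constructor 3]; lia.
Qed.

Lemma nand_nodesE : nand_nodes C o = [seq (i, P i) | i <- iota 0 m].
Proof.
have -> : m = 3 * size C + 1 by rewrite addn1.
rewrite iotaD map_cat /= add0n nand_preds_last; congr (_ ++ _).
have : forall n, n <= size C -> flatten [seq [:: (3 * j, first_preds (node C j));
                   ((3 * j).+1, second_preds j (node C j));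
                   ((3 * j).+2, [:: (3 * j).+1])] | j <- iota 0 n] =
    [seq (i, P i) | i <- iota 0 (3 * n)].
  elim=> // n IH hn; have -> : 3 * n.+1 = 3 * n + 3 by lia.
  rewrite -(addn1 n) (iotaD 0 n 1) (iotaD 0 (3 * n) 3) !map_cat flatten_cat IH; last exact: ltnW.
  congr (_ ++ _).
  by rewrite !add0n /= nand_preds0 // nand_preds1 // nand_preds2.
by apply.
Qed.

Lemma verticesE : vertices C o = nand_vertices m P.
Proof.
rewrite /vertices /nand_vertices nand_nodesE; congr flatten; apply: eq_map => c.
by rewrite -map_comp.
Qed.

Hypothesis C_wf : circuit_wf C.
Hypothesis o_lt : o < size C.

Lemma first_preds_lt j i : j < size C -> i \in first_preds (node C j) -> i < 3 * j.
Proof.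
move=> hj; rewrite /first_preds.
by case: ifP => _ /mapP[k hk ->]; have := circuit_wf_topological C_wf hj hk; lia.
Qed.

Lemma nand_preds_lt i j : i < m -> j \in P i -> j < i.
Proof.
move=> /nand_cases[->|[k hk [] ->]].
- by rewrite nand_preds_last inE => /eqP ->; lia.
- by rewrite nand_preds0 //; apply: first_preds_lt.
- rewrite nand_preds1 // /second_preds; case: ifP => _.
    by move/(first_preds_lt hk); lia.
  by rewrite inE => /eqP ->.
by rewrite nand_preds2 // inE => /eqP ->.
Qed.

Lemma first_preds_nil j :
  j < size C -> first_preds (node C j) = [::] -> is_input (node C j).
Proof.
move=> hj; rewrite -(preds_nil C_wf hj) /first_preds.
by case: ifP => _; case: (preds _).
Qed.

(** Sources come from inputs alone, so choosing k sources of the network amounts to choosing k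
    inputs to be true. *)
Lemma nand_preds_nil i : i < m ->
  P i = [::] <-> exists2 j, j < size C & i = 3 * j /\ is_input (node C j).
Proof.
move=> hi; split=> [|[j hj [-> hin]]]; last first.
  by rewrite nand_preds0 // /first_preds; case: (node C j) hin.
have [->|[j hj [] ->]] := nand_cases hi.
- by rewrite nand_preds_last.
- by rewrite nand_preds0 // => /(first_preds_nil hj); exists j.
- rewrite nand_preds1 // /second_preds; case: ifP => // ja /(first_preds_nil hj).
  by case: (node C j) ja.
by rewrite nand_preds2.
Qed.

Section Evaluation.

Variables (S : pred nat) (a : nat -> bool).
Hypothesis S_source : forall i, S i -> i < m /\ P i = [::].
Hypothesis aS : forall j, j < size C -> is_input (node C j) -> S (3 * j) = a j.

Local Notation value := (nth false (circuit_vals a C)).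

Lemma nand_valS l i : nand_val P S l.+1 i = S i || has (fun j => ~~ nand_val P S l j) (P i).
Proof. by []. Qed.

Lemma S_nonsource i : P i != [::] -> S i = false.
Proof. by move/negP=> h; apply/negP => /S_source[_ e]; apply: h; rewrite e. Qed.

Lemma nand_val_input j L : j < size C -> is_input (node C j) ->
  nand_val P S L (3 * j) = value j.
Proof.
move=> hj inp; have P0 : P (3 * j) = [::] by apply/nand_preds_nil; [lia | exists j].
have -> : nand_val P S L (3 * j) = S (3 * j) by case: L => [|L] /=; rewrite ?P0 orbF.
rewrite aS // nth_circuit_vals //; last exact: circuit_wf_topological.
by case: (node C j) inp.
Qed.

(** The exclusive or records that gate 3 j computes the negation in the case of an AND. *)
Lemma nand_val_first j L : j < size C -> ~~ is_input (node C j) ->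
  (forall i, i \in preds (node C j) ->
     nand_val P S L (3 * i).+1 = ~~ value i /\ nand_val P S L (3 * i).+2 = value i) ->
  nand_val P S L.+1 (3 * j) = value j (+) is_and (node C j).
Proof.
move=> hj inp IH; have P0 := nand_preds0 hj.
rewrite nand_valS S_nonsource; last first.
  by rewrite P0; apply: contra inp => /eqP /(first_preds_nil hj).
rewrite P0 nth_circuit_vals //=; last exact: circuit_wf_topological.
rewrite /first_preds; case: (node C j) inp IH => //= [i|s|s] _ IH.
- by rewrite addbF orbF (proj2 (IH i (mem_head _ _))).
- rewrite addbT has_map -has_predC; apply: eq_in_has => i /IH[_ h].
  by rewrite /= h.
rewrite addbF has_map; apply: eq_in_has => i /IH[h _].
by rewrite /= h negbK.
Qed.

(** For an AND, gate 3 j + 1 copies gate 3 j and is compared with it at level L + 1; otherwise it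
    negates gate 3 j, which is then evaluated at level L. Hence both hypotheses on 3 j. *)
Lemma nand_val_second j L : j < size C ->
  nand_val P S L (3 * j) = value j (+) is_and (node C j) ->
  nand_val P S L.+1 (3 * j) = value j (+) is_and (node C j) ->
  nand_val P S L.+1 (3 * j).+1 = ~~ value j.
Proof.
move=> hj hL hL'; have P1 := nand_preds1 hj.
have S1 : S (3 * j).+1 = false.
  apply/negP => /S_source[hm /nand_preds_nil]; case=> // k _ [? _]; lia.
rewrite nand_valS S1 P1 /second_preds; case: ifP hL hL' => ja hL hL'.
  rewrite -(nand_preds0 hj) -addbT -hL' nand_valS.
  rewrite S_nonsource // nand_preds0 //; apply/negP => /eqP /(first_preds_nil hj).
  by case: (node C j) ja.
by rewrite /= hL addbF orbF.
Qed.

Lemma nand_val_third j L : j < size C ->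
  nand_val P S L (3 * j).+1 = ~~ value j -> nand_val P S L.+1 (3 * j).+2 = value j.
Proof.
by move=> hj hL; rewrite nand_valS S_nonsource nand_preds2 //= hL negbK orbF.
Qed.

(** One circuit level costs three network levels: gate 3 j is right from 3 l on, and each of its two
    successors needs one level more. The claim is for all larger L, because in-neighbours may lie at
    different depths. *)
Lemma nand_val_shallow l w j : shallow l w C j -> j < size C ->
  (forall L, 3 * l < L -> nand_val P S L (3 * j).+1 = ~~ value j) /\
  (forall L, (3 * l).+1 < L -> nand_val P S L (3 * j).+2 = value j).
Proof.
move=> sh hj.
suff first L : 3 * l <= L -> nand_val P S L (3 * j) = value j (+) is_and (node C j).
  have second L : 3 * l < L -> nand_val P S L (3 * j).+1 = ~~ value j.
    by case: L => // L hL; apply: nand_val_second; rewrite ?first //; lia.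
  by split=> // -[|L] // hL; apply: nand_val_third => //; apply: second.
elim: l w j sh hj L => [|l IH] w j sh hj L hL.
  have pn : preds (node C j) = [::].
    by move: sh => /=; case: ifP => _; [case/andP=> _|]; move/nilP.
  have inp : is_input (node C j) by rewrite -preds_nil ?pn.
  by rewrite nand_val_input //; case: (node C j) inp; rewrite // addbF.
case inp : (is_input (node C j)).
  by rewrite nand_val_input //; case: (node C j) inp; rewrite // addbF.
have [w' /allP sh'] : exists w', all (shallow l w' C) (preds (node C j)).
  by move: sh => /=; case: ifP => _; [case/andP=> _ h; exists w.-1 | exists w].
case: L hL => [|L] hL; first lia.
apply: nand_val_first; rewrite ?inp // => i hi.
have ij := ltn_trans (circuit_wf_topological C_wf hj hi) hj.
have first := IH w' i (sh' i hi) ij.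
have second L' : 3 * l < L' -> nand_val P S L' (3 * i).+1 = ~~ value i.
  by case: L' => // L' hL'; apply: nand_val_second; rewrite ?first //; lia.
split; first by apply: second; lia.
by case: L hL => [|L] hL; [lia | apply: nand_val_third => //; apply: second; lia].
Qed.

End Evaluation.

Lemma nand_satisfiable h t k : shallow h t C o ->
  (exists s : seq nat, [/\ size s = k, uniq s,
    forall i, i \in s -> i < m /\ P i = [::] & nand_val P (mem s) (3 * h).+3 m.-1]) <->
  (exists2 a : nat -> bool, weight a C = k & nth false (circuit_vals a C) o).
Proof.
move=> sh.
have out (S : pred nat) a : (forall i, S i -> i < m /\ P i = [::]) ->
    (forall j, j < size C -> is_input (node C j) -> S (3 * j) = a j) ->
    nand_val P S (3 * h).+3 m.-1 = nth false (circuit_vals a C) o.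
  (* The last gate uses one level and negates gate 3 o + 1, which is right at every level above 3
     h. *)
  move=> hS hSa; have [second _] := nand_val_shallow hS hSa sh o_lt.
  rewrite nand_valS [m.-1]/(3 * size C) (S_nonsource hS) nand_preds_last //.
  by rewrite orFb has_seq1 second ?negbK.
split=> [[s [sk s_uniq hs hv]]|[a ak hv]].
  (* Multiplication by 3 is the correspondence between the true inputs and the chosen sources; it
     preserves their number. *)
  exists (fun j => 3 * j \in s); last by rewrite -(out (mem s)).
  rewrite /weight -size_filter -sk -(size_map (muln 3)); apply: perm_size.
  apply: uniq_perm => //.
    by rewrite map_inj_uniq ?filter_uniq ?iota_uniq // => x y; lia.
  move=> i; apply/mapP/idP => [[j]|si].
    by rewrite mem_filter => /andP[/andP[_ js] _] ->.
  have [hm /(nand_preds_nil hm)[j hj [ij inp]]] := hs i si.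
  by exists j; rewrite // mem_filter inp -ij si mem_iota.
pose r := [seq j <- iota 0 (size C) | is_input (node C j) && a j].
have mem_r j : (3 * j \in [seq 3 * i | i <- r]) = (j \in r).
  by apply: mem_map => x y; lia.
have hr i : i \in [seq 3 * i | i <- r] -> i < m /\ P i = [::].
  case/mapP=> j; rewrite mem_filter mem_iota => /andP[/andP[inp _] /= hj] ->.
  have hm : 3 * j < m by rewrite /m; lia.
  by split=> //; apply/(nand_preds_nil hm); exists j.
exists [seq 3 * i | i <- r]; split=> //.
- by rewrite size_map size_filter.
- by rewrite map_inj_uniq ?filter_uniq ?iota_uniq // => x y; lia.
rewrite (out _ a) // => j hj inp.
by rewrite [LHS]mem_r mem_filter inp mem_iota /= hj andbT.
Qed.

End NandPreds.

(** * The reduction *)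

Ltac ptime_extra ::=
  first [ simple eapply encode_tree_inj | match goal with H : _ |- _ => simple eapply H end
  | simple eapply ptime_hd | simple eapply ptime_tl | simple eapply ptime_dec_nat
  | simple eapply ptime_dec_circuit | simple eapply ptime_enc_nat
  | simple eapply ptime_FAdj | simple eapply ptime_FEq | simple eapply ptime_FNot
  | simple eapply ptime_FAnd | simple eapply ptime_FOr | simple eapply ptime_FEx
  | simple eapply ptime_FAll | simple eapply ptime_foldr_FOr
  | simple eapply ptime_foldr_FAnd | simple eapply ptime_foldr_FEx
  | simple eapply ptime_enc_fo | simple eapply ptime_fo_length ].

(** Only the list X is input here: the number of levels is a constant and becomes part of the
    program. *)
Lemma ptime_fVal l : ptime (fun X : seq nat => fVal X l).
Proof.
elim: l => [|l IH]; first by rewrite /fVal /fIn; solve_ptime.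
by rewrite /fVal -/fVal /fIn; solve_ptime.
Qed.

Lemma ptime_fSat L : ptime (fSat L).
Proof.
have hX : ptime (fun k => [seq L.+1.+4 + i | i <- iota 0 k]) by solve_ptime.
apply: (ptime_comp (f := fun k => [seq L.+1.+4 + i | i <- iota 0 k])
  (g := fun X => foldr FEx (fBody X L) X) hX).
have hV := ptime_fVal L; apply: ptime_foldr_FEx; last by solve_ptime.
rewrite /fBody /fDistinct /fLast /fSource /fPred /fLess /fTwin /fIff.
by solve_ptime.
Qed.

Definition enc_graph (V : seq vertex) : tree :=
  Node (enc_nat (dimension V))
    (Node (enc_nat (radius V)) (encode [seq vec adj V v | v <- V])).

(** Everything in [WCS] but satisfiability is tested. If a test fails, the result is [Leaf], which
    codes no instance and so is a no-instance. *)
Definition reduction (t h : nat) (p : tree * nat) : tree * nat :=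
  let C := dec_circuit (tree_hd p.1) in
  let o := dec_nat (tree_tl p.1) in
  let phi := fSat (3 * h).+3 p.2 in
  if [&& p.1 == encode (C, o), circuit_wf C, is_output C o & shallow h t C o]
  then (Node (enc_fo phi) (enc_graph (vertices C o)), fo_length phi)
  else (Leaf, 0).

Lemma ptime_reduction t h : ptime (reduction t h).
Proof.
have hC : ptime (fun p : tree * nat => (dec_circuit (tree_hd p.1), dec_nat (tree_tl p.1))).
  by solve_ptime.
have h1 := ptime_comp hC (ptime_shallow h t).
have h2 := ptime_comp hC ptime_is_output.
have h3 := ptime_comp (ptime_fst hC) ptime_circuit_wf.
have hV := ptime_comp hC ptime_vertices.
have h4 := ptime_comp hV ptime_vecs.
have h5 : ptime (fun p : tree * nat => fSat (3 * h).+3 p.2).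
  by apply: ptime_comp (ptime_fSat _); solve_ptime.
rewrite /reduction /enc_graph /dimension /radius.
by solve_ptime.
Qed.

Lemma enc_fo_inj : injective enc_fo.
Proof.
elim=> [x y|x y|f IH|f IHf g IHg|f IHf g IHg|x f IH|x f IH] [x' y'|x' y'|f'|f' g'|f' g'|x' f'|x' f'] //=.
- by case=> /encode_nat_inj -> /encode_nat_inj ->.
- by case=> /encode_nat_inj -> /encode_nat_inj ->.
- by case=> /IH ->.
- by case=> /IHf -> /IHg ->.
- by case=> /IHf -> /IHg ->.
- by case=> /encode_nat_inj -> /IH ->.
by case=> /encode_nat_inj -> /IH ->.
Qed.

Lemma encode_bool_inj : injective (encode : bool -> tree).
Proof. by case=> [] []. Qed.

Lemma enc_instanceE phi (e : rel vertex) V :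
  enc_instance phi (radius V) (cubes e V) =
  Node (enc_fo phi) (Node (enc_nat (dimension V))
    (Node (enc_nat (radius V)) (encode [seq vec e V v | v <- V]))).
Proof. by rewrite /enc_instance /cubes -map_comp. Qed.

(** [Q_FO_model_checking] asserts that some decoding of the tree is a yes-instance; injectivity
    identifies it with the instance that was encoded. *)
Lemma enc_instance_inj phi d r (vs : seq (d.-tuple bool)) phi' d' r' (vs' : seq (d'.-tuple bool)) :
  enc_instance phi r vs = enc_instance phi' r' vs' ->
  [&& sentence phi', uniq vs' & ~~ nilp vs'] ->
  models (@induced _ (power (@hypercube d') r') vs') phi' ->
  phi = phi' /\ models (@induced _ (power (@hypercube d) r) vs) phi.
Proof.
case=> /enc_fo_inj -> /encode_nat_inj ed /encode_nat_inj ->.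
(* The lists can be compared only after the dimensions have been identified, as their types depend
   on these. *)
case: d' / ed vs' => vs' evs _ h; split=> //.
suff -> : vs = vs' by [].
by apply: (inj_map val_inj); apply: (encode_seq_inj (encode_seq_inj encode_bool_inj)).
Qed.

Lemma reduction_correct t h x k :
  WCS t h x k <-> Q_FO_model_checking (reduction t h (x, k)).1 (reduction t h (x, k)).2.
Proof.
rewrite /reduction /=; set C := dec_circuit _; set o := dec_nat _; set phi := fSat _ _.
case: ifP => [/and4P[/eqP xE wf out sh]|no]; last first.
  split=> [[C' [o' [xE /andP[wf out] hw hd _]]]|[phi' [d [r [vs [] //]]]]].
  have CE : C = C' by rewrite /C xE /= enc_circuitK.
  have oE : o = o' by rewrite /o xE /= enc_natK.
  move: no; rewrite CE oE wf out.
  have ho : o' < size C' by case/andP: out.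
  by rewrite xE eqxx (proj2 (shallow_depth_weft h t wf ho) (conj hw hd)).
have ho : o < size C by case/andP: out.
have [hw hd] := proj1 (shallow_depth_weft h t wf ho) sh.
pose m := (3 * size C).+1; pose P := nand_preds C o.
have P_lt i j : i < m -> j \in P i -> j < i := @nand_preds_lt _ _ wf ho i j.
set V := vertices C o; have VE : V = nand_vertices m P := verticesE C o.
have V_uniq : uniq V.
  have -> : V = [seq (c, x) | c <- [:: 0; 1; 2], x <- [seq (i, P i) | i <- iota 0 m]].
    rewrite VE /nand_vertices; congr flatten; apply: eq_map => c.
    by rewrite -map_comp.
  rewrite allpairs_uniq // ?map_inj_uniq ?iota_uniq // => [i j [] //|[a b] [a' b'] _ _ [-> ->] //].
have adj_irr v : v \in V -> ~~ adj v v.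
  rewrite VE mem_nand_vertices => /and3P[_ hi /eqP hp].
  apply/negP; rewrite /adj; case: (v.1 == 0) => //=.
  by rewrite hp => /(P_lt _ _ hi); rewrite ltnn.
have main : models (@induced _ (power (@hypercube (dimension V)) (radius V)) (cubes adj V)) phi <->
  exists2 a : nat -> bool, weight a C = k & nth false (circuit_vals a C) o.
  rewrite models_cubes // -(nand_satisfiable wf ho k sh).
  rewrite -(models_fSat P_lt) //.
  by move: (VE); rewrite -/V => ->.
have instE : Node (enc_fo phi) (enc_graph V) = enc_instance phi (radius V) (cubes adj V).
  by rewrite enc_instanceE.
rewrite -/V instE; split=> [[C' [o' [xE' _ _ _ hsat]]]|[phi' [d [r [vs [E hvs len hmod]]]]]].
  have CE : C = C' by rewrite /C xE' /= enc_circuitK.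
  have oE : o = o' by rewrite /o xE' /= enc_natK.
  exists phi, (dimension V), (radius V), (cubes adj V); split=> //.
    rewrite sentence_fSat /=; apply/andP; split.
      by rewrite map_inj_in_uniq // => v w vV wV; apply: cube_inj.
    by rewrite /cubes; case: (V) VE => //; rewrite /nand_vertices /m /=.
  by apply/main; rewrite CE oE.
have [_ h'] := enc_instance_inj E hvs hmod.
exists C, o; split=> //; first by rewrite wf.
exact/main.
Qed.

(** * Composition with an arbitrary given reduction *)

Fixpoint expr_bound (e : expr) : nat :=
  match e with
  | EVar x => x.+1
  | ENil => 0
  | ECons a b | EEq a b => maxn (expr_bound a) (expr_bound b)
  | EHd a | ETl a => expr_bound a
  end.

Fixpoint cmd_bound (c : cmd) : nat :=
  match c with
  | CAssign x e => maxn x.+1 (expr_bound e)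
  | CSeq a b => maxn (cmd_bound a) (cmd_bound b)
  | CIf e a b => maxn (expr_bound e) (maxn (cmd_bound a) (cmd_bound b))
  | CWhile e a => maxn (expr_bound e) (cmd_bound a)
  end.

Lemma eval_agree N s s2 e :
  (forall x, x < N -> s x = s2 x) -> expr_bound e <= N ->
  eval s e = eval s2 e /\ expr_cost s e = expr_cost s2 e.
Proof.
move=> h; elim: e => //= [x /h -> //|a IHa b IHb|a IHa|a IHa|a IHa b IHb].
- by rewrite geq_max => /andP[/IHa[-> ->] /IHb[-> ->]].
- by case/IHa=> -> ->.
- by case/IHa=> -> ->.
by rewrite geq_max => /andP[/IHa[-> ->] /IHb[-> ->]].
Qed.

(* A given program may rely on its scratch variables being Leaf, so values can
   be kept across it only in variables it does not mention. *)
Lemma exec_frame c s s' t : exec c s s' t ->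
  forall N s2, cmd_bound c <= N -> (forall x, x < N -> s x = s2 x) ->
  exists s2', [/\ exec c s2 s2' t, forall x, x < N -> s' x = s2' x
    & forall x, N <= x -> s2' x = s2 x].
Proof.
elim=> {c s s' t}.
- move=> s x e N s2 /=; rewrite geq_max => /andP[xN eN] h.
  have [ev ->] := eval_agree h eN; rewrite ev.
  exists (update s2 x (eval s2 e)); split; first exact: exec_assign.
    by move=> y yN; rewrite !updateE h.
  by move=> y yN; rewrite update_neq //; apply: contraTneq yN => ->; rewrite -ltnNge.
- move=> c1 c2 s s1 s2 t1 t2 _ IH1 _ IH2 N r /=; rewrite geq_max => /andP[n1 n2] h.
  have [r1 [e1 a1 f1]] := IH1 N r n1 h; have [r2 [e2 a2 f2]] := IH2 N r1 n2 a1.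
  by exists r2; split=> //; [apply: exec_seq e1 e2 | move=> x hx; rewrite f2 ?f1].
- move=> e c1 c2 s s1 t1 ev _ IH N r /=; rewrite !geq_max => /and3P[n n1 n2] h.
  have [r1 [e1 a1 f1]] := IH N r n1 h; have [ee ec] := eval_agree h n.
  by exists r1; split=> //; rewrite ec; apply: exec_if_true e1; rewrite -ee.
- move=> e c1 c2 s s1 t1 ev _ IH N r /=; rewrite !geq_max => /and3P[n n1 n2] h.
  have [r1 [e1 a1 f1]] := IH N r n2 h; have [ee ec] := eval_agree h n.
  by exists r1; split=> //; rewrite ec; apply: exec_if_false e1; rewrite -ee.
- move=> e c s ev N r /=; rewrite geq_max => /andP[n n1] h.
  have [ee ec] := eval_agree h n; exists r; split=> //.
  by rewrite ec; apply: exec_while_false; rewrite -ee.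
move=> e c s s1 s2 t1 t2 ev _ IH1 _ IH2 N r /= nN h.
move: (nN); rewrite geq_max => /andP[n n1].
have [r1 [e1 a1 f1]] := IH1 N r n1 h; have [r2 [e2 a2 f2]] := IH2 N r1 nN a1.
have [ee ec] := eval_agree h n; exists r2; split=> //; last by move=> x hx; rewrite f2 ?f1.
by rewrite ec; apply: exec_while_true e1 e2; rewrite -ee.
Qed.

(** G needs k besides f k, but the program for f may destroy its input. So k is kept in a variable
    that this program does not mention, and [exec_frame] transfers its run to the store so
    modified. *)
Lemma computable_ptime (f : nat -> nat) (G : nat * nat -> nat) :
  computable f -> ptime G -> computable (fun k => G (f k, k)).
Proof.
move=> [p hp] [c [Nc [C [D [Nc_gt0 hc]]]]]; pose N := maxn Nc (cmd_bound p).
exists (CSeq (CAssign N (EVar 0)) (CSeq p (CSeq (CAssign 0 (ECons (EVar 0) (EVar N))) c))) => k.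
have [t1 [s1 e1 v1]] := hp k.
set s0 := update (fun=> Leaf) 0 (enc_nat k) in e1 *.
pose s0' := update s0 N (s0 0).
have agree x : x < N -> s0 x = s0' x.
  by move=> xN; rewrite /s0' update_neq //; lia.
have [s1' [e1' a1 f1]] := exec_frame e1 (leq_maxr Nc _) agree.
pose s2 := update s1' 0 (Node (s1' 0) (s1' N)).
have [|s3 [t3 [e3 v3 _ _]]] := hc s2 (f k, k).
  by rewrite /s2 update_eq (f1 N) // /s0' update_eq -(a1 0) ?v1 //; lia.
exists ((expr_cost s0 (EVar 0)).+1 + (t1 + ((expr_cost s1' (ECons (EVar 0) (EVar N))).+1 + t3))).
exists s3 => //; have h0 := exec_assign s0 N (EVar 0); apply: (exec_seq h0).
apply: exec_seq e1' _; have h1 := exec_assign s1' 0 (ECons (EVar 0) (EVar N)).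
exact: (exec_seq h1 e3).
Qed.

Lemma ptime_pol {A} {eA : encodable A} C D (f : A -> nat) :
  ptime f -> ptime (fun a => pol C D (f a)).
Proof.
move=> hf; apply: ptime_mul (ptime_const _) _.
by apply: ptime_exp; apply: ptime_succ.
Qed.

(** With X the size of x and F = f1 k, the size of the intermediate instance plus one is at most (F
    + 2 k + 4) X^(c+1). Its D-th power splits into a factor depending on k only and a power of X;
    the exponent (c+1)(D+1) covers this power as well as X^c. *)
Lemma fpt_reduces_ptime (P Q R : param_problem) (f : tree * nat -> tree * nat) C0 D0 :
  fpt_reduces P Q -> ptime f ->
  (forall x k, Q x k <-> R (f (x, k)).1 (f (x, k)).2) ->
  (forall x k, (f (x, k)).2 <= pol C0 D0 k) ->
  fpt_reduces P R.
Proof.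
move=> [p [f1 [g1 [c [f1_comp g1_comp hp]]]]] [c2 [N [C [D [_ hc2]]]]] hf hlen.
exists (CSeq p c2), (fun k => f1 k + pol C D (f1 k + 2 * k + 3)), (fun k => pol C0 D0 (g1 k)),
  (c.+1 * D.+1); split.
- apply: (computable_ptime (G := fun q => q.1 + pol C D (q.1 + 2 * q.2 + 3)) f1_comp).
  by have hpol := @ptime_pol (nat * nat) _; solve_ptime; apply: ptime_pol; solve_ptime.
- apply: (computable_ptime (G := fun q => pol C0 D0 q.1) g1_comp).
  by apply: ptime_pol; solve_ptime.
move=> x k; have [x' [k' [t1 [[s1 e1 v1] ht1 hk' hPQ]]]] := hp x k.
have [s2 [t2 [e2 v2 _ ht2]]] := hc2 s1 (x', k') v1.
exists (f (x', k')).1, (f (x', k')).2, (t1 + t2); split.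
- by exists s2; [apply: exec_seq e1 e2 | rewrite v2].
- set X := tree_size x; have X_gt0 : 0 < X := tree_size_gt0 x.
  set F := f1 k in ht1 *.
  (* The size of the input pair of the given program, plus its running time. *)
  have sz : tree_size (encode (x', k')) <= X + (2 * k).+1 + 1 + t1.
    have := exec_size e1 0; rewrite v1 update_eq -[tree_size (Node x (enc_nat k))]/((X + tree_size (encode k)).+1) encode_nat_size.
    have -> : Node x' (enc_nat k') = encode (x', k') by [].
    lia.
  have mono n1 n2 : n1 <= n2 -> X ^ n1 <= X ^ n2 by apply: leq_pexp2l.
  have b1 : t1 <= F * X ^ (c.+1 * D.+1).
    by apply: leq_trans ht1 _; rewrite leq_mul2l mono ?orbT // mulnS; lia.
  have b2 : (tree_size (encode (x', k'))).+1 <= (F + 2 * k + 3).+1 * X ^ c.+1.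
    have h1 : F * X ^ c <= F * X ^ c.+1 by rewrite leq_mul2l mono ?orbT.
    have h2 : X <= X ^ c.+1 by rewrite -{1}(expn1 X) mono.
    have h3 : 2 * k + 3 <= (2 * k + 3) * X ^ c.+1 by rewrite leq_pmulr ?expn_gt0 ?X_gt0.
    have -> : (F + 2 * k + 3).+1 * X ^ c.+1 = F * X ^ c.+1 + (2 * k + 3) * X ^ c.+1 + X ^ c.+1.
      by rewrite mulSn addnC -(addnA F) mulnDl.
    move: h1 h2 h3 ht1; set a := F * _; set b := F * _; set d := (_ + 3) * _.
    set y := X ^ c.+1; lia.
  have b3 : t2 <= pol C D (F + 2 * k + 3) * X ^ (c.+1 * D.+1).
    apply: leq_trans ht2 _; rewrite /pol -mulnA leq_mul2l; apply/orP; right.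
    apply: leq_trans (leq_exp2r' D b2) _.
    by rewrite expnMn -expnM leq_mul2l mono ?orbT // leq_mul2l leqnSn orbT.
  by rewrite mulnDl leq_add.
- by apply: leq_trans (hlen x' k') _; apply: pol_mono.
by rewrite hPQ.
Qed.

(** The formula is computed from k alone, in polynomial time, and its code contains its length in
    unary; so the new parameter is polynomial in k, whatever the circuit. *)
Lemma reduction_length t h : exists C D, forall x k, (reduction t h (x, k)).2 <= pol C D k.
Proof.
have [C [D hC]] := ptime_size (ptime_fSat (3 * h).+3).
have [C' [D' hC']] : poly_bounded (fun n => pol C D (2 * n).+1) by poly_bound.
exists C', D' => x k; rewrite /reduction; case: ifP => // _ /=.
apply: leq_trans (hC' k); rewrite -encode_nat_size; apply: leq_trans (hC k).
by rewrite encode_fo_size; lia.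
Qed.

Theorem theorem10 (t : nat) (ht : 1 <= t) : W_hard t Q_FO_model_checking.
Proof.
move=> P [h _ hP]; have [C [D hlen]] := reduction_length t h.
exact: fpt_reduces_ptime hP (ptime_reduction t h) (reduction_correct t h) hlen.
Qed.
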